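(* Let $n\ge2$ and let $\mathfrak{g}_{K_n}$ be the dynamical Lie algebra of QAOA-MaxCut on the complete graph $K_n$, with center $\mathfrak{c}$. Then $\mathfrak{g}_{K_n}=\mathfrak{c}\oplus[\mathfrak{g}_{K_n},\mathfrak{g}_{K_n}]$, where the semisimple component has dimension $$\dim([\mathfrak{g}_{K_n},\mathfrak{g}_{K_n}])=\begin{cases}\frac1{12}(n^3+6n^2+2n)& n\text{ even},\\ \frac1{12}(n^3+6n^2-n-6)& n\text{ odd},\end{cases}$$ and basis $$\{X^pY^qZ^r\}\ \cup\ \{[X^1,X^pY^qZ^r]\}\ \cup\ \{[Z^2,X^pY^1Z^r]\},$$ where in the first two families $(p,q,r)$ ranges over all triples of integers with $p\ge0$, $q,r\ge1$ odd and $p+q+r\le n$, and in the third family $(p,r)$ ranges over all pairs with $p\ge0$, $r\ge1$ odd and $p+1+r\le n$. Moreover $\dim(\mathfrak{c})=1+\mathrm{parity}(n)$, where $\mathrm{parity}(n)=1$ if $n$ is odd and $0$ if $n$ is even.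
   Context: $X_j,Y_j,Z_j$ are the Pauli matrices acting on qubit $j\in[n]=\{1,\dots,n\}$. $\mathfrak{g}_{K_n}\subseteq\mathfrak{su}(2^n)$ is the real Lie algebra (bracket $[A,B]=AB-BA$) generated by $i\sum_{j}X_j$ and $i\sum_{1\le j<k\le n}Z_jZ_k$. For non-negative integers $p,q,r$ with $p+q+r\le n$, the single symbol $X^pY^qZ^r$ denotes the matrix $i\sum X_RY_SZ_T$, the sum over all mutually disjoint $R,S,T\subseteq[n]$ with $|R|=p$, $|S|=q$, $|T|=r$, where $X_R=\prod_{j\in R}X_j$, and similarly $Y_S,Z_T$. Factors with exponent $0$ are omitted from the notation; in particular $X^1=i\sum_jX_j$ and $Z^2=i\sum_{j<k}Z_jZ_k$ are the generators. *)

(* Defs.v *)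
From HB Require Import structures.
From mathcomp Require Import all_boot all_order all_algebra.
From mathcomp Require Import reals.
From mathcomp.real_closed Require Import complex mxtens.

Set Implicit Arguments.
Unset Strict Implicit.
Unset Printing Implicit Defensive.

Import Order.TTheory GRing.Theory Num.Theory.
Local Open Scope ring_scope.
Local Open Scope complex_scope.

(* 'M[R[i]]_N as a vector space over the REAL field R.  The alias is needed   *)
(* because 'M[R[i]]_N itself is canonically a vector space over R[i].         *)
Definition cmat (R : rcfType) (N : nat) := 'M[R[i]]_N.

Section RealVectorSpace.
Variables (R : rcfType) (N : nat).

HB.instance Definition _ := GRing.Zmodule.copy (cmat R N) 'M[R[i]]_N.

Definition cmat_scale (a : R) (A : cmat R N) : cmat R N :=
  (a%:C : R[i]) *: (A : 'M[R[i]]_N).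

Fact cmat_scaleA a b A : cmat_scale a (cmat_scale b A) = cmat_scale (a * b) A.
Proof. by rewrite /cmat_scale scalerA rmorphM. Qed.
Fact cmat_scale1 : left_id 1 cmat_scale.
Proof. by move=> A; rewrite /cmat_scale rmorph1 scale1r. Qed.
Fact cmat_scaleDr : right_distributive cmat_scale +%R.
Proof. by move=> a A B; apply: scalerDr. Qed.
Fact cmat_scaleDl A : {morph cmat_scale^~ A : a b / a + b}.
Proof. by move=> a b; rewrite /cmat_scale rmorphD scalerDl. Qed.

HB.instance Definition _ := GRing.Zmodule_isLmodule.Build R (cmat R N)
  cmat_scaleA cmat_scale1 cmat_scaleDr cmat_scaleDl.

Lemma cmat_scaleE (a : R) (A : cmat R N) :
  a *: A = (a%:C : R[i]) *: (A : 'M[R[i]]_N) :> 'M[R[i]]_N.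
Proof. by []. Qed.

Fact cmat_vect_axiom : Vector.axiom (N * N + N * N) (cmat R N).
Proof.
pose f (A : cmat R N) : 'rV[R]_(N * N + N * N) :=
  row_mx (mxvec (map_mx (@complex.Re R) A)) (mxvec (map_mx (@complex.Im R) A)).
exists f.
  move=> a A B; rewrite /f scale_row_mx add_row_mx.
  congr (row_mx _ _); rewrite -linearP; congr mxvec; apply/matrixP=> i j;
    rewrite !mxE; case: (A i j) (B i j) => [x y] [z t] /=.
    by rewrite mul0r subr0.
  by rewrite mul0r addr0.
exists (fun v => \matrix_(i, j)
  Complex (vec_mx (lsubmx v) i j) (vec_mx (rsubmx v) i j)) => [A|v].
  apply/matrixP=> i j; rewrite mxE /f row_mxKl row_mxKr !mxvecK !mxE.
  by case: (A i j).
rewrite /f -[RHS]hsubmxK; congr (row_mx _ _).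
  by rewrite -[RHS]vec_mxK; congr mxvec; apply/matrixP=> i j; rewrite !mxE.
by rewrite -[RHS]vec_mxK; congr mxvec; apply/matrixP=> i j; rewrite !mxE.
Qed.

HB.instance Definition _ :=
  Lmodule_hasFinDim.Build R (cmat R N) cmat_vect_axiom.

End RealVectorSpace.

Section LieTheory.
Variables (R : rcfType) (N : nat).
Local Notation T := (cmat R N).
Implicit Types (A B : T) (U V W g h I : {vspace T}) (s : seq T).

Definition lie A B : T :=
  (A : 'M[R[i]]_N) *m (B : 'M[R[i]]_N) - (B : 'M[R[i]]_N) *m (A : 'M[R[i]]_N).

Fact lie_is_linear A : linear (lie A).
Proof.
move=> a B C; rewrite /lie !cmat_scaleE.
rewrite mulmxDr mulmxDl -scalemxAr -scalemxAl scalerBr.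
by rewrite opprD addrACA.
Qed.
HB.instance Definition _ A := GRing.isLinear.Build R T T *:%R (lie A)
  (lie_is_linear A).

Lemma lieC A B : lie A B = - lie B A.
Proof. by rewrite /lie opprB. Qed.

(* [U, V]: the real span of all brackets of an element of U with one of V. *)
Definition lie_prod U V : {vspace T} :=
  <<[seq lie A B | A <- vbasis U, B <- vbasis V]>>%VS.

Lemma mem_lie_prod U V A B :
  A \in U -> B \in V -> lie A B \in lie_prod U V.
Proof.
have lieW g (W : {vspace T}) C :
    {in vbasis g, forall D, lie C D \in W} -> {in g, forall D, lie C D \in W}.
  move=> HW D /coord_vbasis->; rewrite linear_sum.
  apply: memv_suml => j _; rewrite linearZ; apply: memvZ.
  by apply/HW/memt_nth.
move=> AU; apply: (lieW) => D DV; rewrite lieC memvN; move: A AU.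
apply: lieW => C CU; rewrite lieC memvN memv_span //.
exact: allpairs_f.
Qed.

Lemma lie_prodP U V W :
  reflect (forall A B, A \in U -> B \in V -> lie A B \in W)
          (lie_prod U V <= W)%VS.
Proof.
apply: (iffP idP) => [sUVW A B AU BV | sUVW].
  by rewrite (subvP sUVW) ?mem_lie_prod.
apply/span_subvP=> _ /allpairsP[[A B] /= [AU BV ->]].
by rewrite sUVW ?vbasis_mem.
Qed.

Definition lie_subalg g := (lie_prod g g <= g)%VS.

(* The real Lie algebra generated by s.  Starting from the span of s, the     *)
(* chain U, U + [U, U], ... is stationary after \dim {: T} steps; lie_gen_min *)
(* and the two lemmas before it show that its limit is the least Lie          *)
(* subalgebra containing s.                                                   *)
Definition lie_gen s : {vspace T} :=
  iter (\dim {:T}) (fun U => (U + lie_prod U U)%VS) <<s>>%VS.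

Lemma sub_lie_gen s : (<<s>> <= lie_gen s)%VS.
Proof.
rewrite /lie_gen; elim: (\dim _) => [|k IH] //=.
by apply: subv_trans IH (addvSl _ _).
Qed.

Lemma lie_gen_subalg s : lie_subalg (lie_gen s).
Proof.
rewrite /lie_subalg /lie_gen; set f := fun U => (U + _)%VS.
pose u k := iter k f <<s>>%VS.
have H k : (k <= \dim (u k))%N || (f (u k) == u k).
  elim: k => [|k IH] //; rewrite -[u k.+1]/(f (u k)).
  have [eqf|neq] := eqVneq (f (u k)) (u k); first by rewrite !eqf eqxx orbT.
  move: IH; rewrite (negPf neq) orbF => le; apply/orP; left.
  apply: leq_ltn_trans le _; rewrite ltnNge; apply/negP => le'.
  by case/eqP: neq; apply/esym/eqP; rewrite eqEdim addvSl.
case/orP: (H (\dim {:T})) => [le|/eqP eqf].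
  have -> : iter (\dim {:T}) f <<s>>%VS = fullv.
    by apply/eqP; rewrite eqEdim subvf.
  exact: subvf.
by rewrite -[X in (_ <= X)%VS]eqf addvSr.
Qed.

Lemma lie_gen_min s g :
  {subset s <= g} -> lie_subalg g -> (lie_gen s <= g)%VS.
Proof.
move=> /span_subvP sg /lie_prodP clg; rewrite /lie_gen.
elim: (\dim _) => [|k IH] //=; rewrite subv_add IH.
by apply/lie_prodP => A B /(subvP IH) Ag /(subvP IH) Bg; apply: clg.
Qed.

Definition lie_center g : {vspace T} :=
  (g :&: \bigcap_(i < \dim g) lker (linfun (lie (vbasis g)`_i)))%VS.

Lemma lie_centerP g A :
  reflect (A \in g /\ forall B, B \in g -> lie A B = 0) (A \in lie_center g).
Proof.
rewrite memv_cap; apply: (iffP andP) => -[Ag cA]; split=> //.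
  move=> B /coord_vbasis->; rewrite linear_sum big1 //= => i _.
  rewrite linearZ /= lieC; move/subv_bigcapP: cA => /(_ i isT).
  by rewrite -memvE memv_ker lfunE => /eqP /= ->; rewrite oppr0 scaler0.
rewrite memvE; apply/subv_bigcapP => i _; rewrite -memvE memv_ker lfunE /=.
by rewrite lieC cA ?oppr0 // vbasis_mem // memt_nth.
Qed.

Definition lie_ideal g I := (I <= g)%VS && (lie_prod g I <= I)%VS.

Definition lie_solvable g :=
  exists k, iter k (fun U => lie_prod U U) g = 0%VS.

Definition lie_semisimple g :=
  forall I, lie_ideal g I -> lie_solvable I -> I = 0%VS.

End LieTheory.

Section Pauli.
Variable R : rcfType.

Definition pauliX : 'M[R[i]]_2 := \matrix_(a, b) (a != b)%:R.
Definition pauliY : 'M[R[i]]_2 :=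
  \matrix_(a, b) (if a == b then 0 else if a == 0 then - 'i%C else 'i%C).
Definition pauliZ : 'M[R[i]]_2 :=
  \matrix_(a, b) (if a == b then (-1) ^+ a else 0).

(* A 0 *t A 1 *t ... *t A n.-1.  One factor is split off as the base case so  *)
(* that 2 ^ k.+2 is convertible to 2 * 2 ^ k.+1 and no cast is needed.        *)
Fixpoint bigtens_rec k : ('I_k.+1 -> 'M[R[i]]_2) -> 'M[R[i]]_(2 ^ k.+1) :=
  match k with
  | 0 => fun A => A ord0
  | k'.+1 => fun A => A ord0 *t bigtens_rec (fun j => A (lift ord0 j))
  end.

Definition bigtens n : ('I_n -> 'M[R[i]]_2) -> 'M[R[i]]_(2 ^ n) :=
  match n with
  | 0 => fun=> 1%:M
  | k.+1 => @bigtens_rec k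
  end.

Variable n : nat.

Definition on_qubit (P : 'M[R[i]]_2) (j : 'I_n) : 'M[R[i]]_(2 ^ n) :=
  bigtens (fun k => if k == j then P else 1%:M).

Definition on_qubits (P : 'M[R[i]]_2) (A : {set 'I_n}) : 'M[R[i]]_(2 ^ n) :=
  \big[mulmx/1%:M]_(j in A) on_qubit P j.

Definition XYZ (p q r : nat) : cmat R (2 ^ n) :=
  'i%C *:
  \sum_(t : {set 'I_n} * {set 'I_n} * {set 'I_n} |
      let: (A, B, C) := t in
      [&& #|A| == p, #|B| == q, #|C| == r,
          [disjoint A & B], [disjoint A & C] & [disjoint B & C]])
    (let: (A, B, C) := t in
     on_qubits pauliX A *m on_qubits pauliY B *m on_qubits pauliZ C).

Definition mixer : cmat R (2 ^ n) :=
  'i%C *: \sum_(j < n) on_qubit pauliX j.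

Definition complete_maxcut : cmat R (2 ^ n) :=
  'i%C *: \sum_(j < n) \sum_(k < n | (j < k)%N)
    (on_qubit pauliZ j *m on_qubit pauliZ k).

Definition dla_K : {vspace cmat R (2 ^ n)} :=
  lie_gen [:: mixer; complete_maxcut].

(* The exponents of a triple with p + q + r <= n are at most n, so 'I_n.+1    *)
(* imposes no further bound; odd q forces 1 <= q.                             *)
Definition XYZ_exponents : {set 'I_n.+1 * 'I_n.+1 * 'I_n.+1} :=
  [set t : 'I_n.+1 * 'I_n.+1 * 'I_n.+1 |
    [&& odd t.1.2, odd t.2 & (t.1.1 + t.1.2 + t.2 <= n)%N]].

Definition XZ_exponents : {set 'I_n.+1 * 'I_n.+1} :=
  [set t : 'I_n.+1 * 'I_n.+1 | odd t.2 && (t.1 + 1 + t.2 <= n)%N].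

Definition semisimple_basis : seq (cmat R (2 ^ n)) :=
     [seq XYZ t.1.1 t.1.2 t.2
     | t : 'I_n.+1 * 'I_n.+1 * 'I_n.+1 <- enum XYZ_exponents]
  ++ [seq lie (XYZ 1 0 0) (XYZ t.1.1 t.1.2 t.2)
     | t : 'I_n.+1 * 'I_n.+1 * 'I_n.+1 <- enum XYZ_exponents]
  ++ [seq lie (XYZ 0 0 2) (XYZ t.1 1 t.2)
     | t : 'I_n.+1 * 'I_n.+1 <- enum XZ_exponents].

End Pauli.

(* Main.v *)
(* On the Pauli-string sums X^pY^qZ^r, ad(X^1) rotates Y into Z and ad(Z^2) is  *)

(* Two independent halves meet in [dla_K_derived]. The structural half is general: an invariant form
   that is definite on a Lie algebra splits it into center and derived algebra
   ([lie_center_derived]) and excludes solvable ideals of the latter ([lie_derived_semisimple]).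
   Definiteness on g is [dla_K_definite]: Pauli strings are orthogonal for the trace ([trform_mat]).

   The other half works on monomials, where [adX_XYZ] and [adZ_XYZ] make the generators ladder
   operators. [odd_in_generated] bounds [g, g] from below; [even_cong] and [adZ_odd] show that the
   span of the proposed basis is stable, which bounds it from above through [lie_gen2_derived].
   [basis_free] gets independence from [free_triangular] and the functionals [index_dual]. The
   codimension of [g, g] in g is read off [Z2_notin], [X1_notin] and [X1_in], and the dimension
   formula is the count [size_semisimple_basis]. *)
(* a four-term ladder, as Z^2 is half the square of the sum of the Z_j up to a  *)
(* constant.  Call X^pY^qZ^r odd when q and r are odd.                          *)
(* Generation: ad(Z^2)^2 raises Y Z^r to Y Z^(r+2), ad(X^1)^2 trades Z^2 for    *)
(* Y^2, and ad(X^1) ad(Z^2) raises p, so that from [X^1, Z^2] = 2 Y Z all odd   *)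
(* elements lie in [g, g].                                                      *)
(* Span: modulo [X^1, odd], the even monomials X^pY^(2i)Z^(2j) with i + j = m   *)
(* are binomial multiples of a single one.  Hence [Z^2, X^pY^qZ^r] reduces to   *)
(* the case q = 1, the span h of the proposed basis is stable under both        *)
(* generators, and g = <X^1, Z^2> + h with [g, g] = h.                          *)
(* Independence: the basis is triangular with respect to explicit functionals. *)
(* Center: the trace form is definite on g, so g = c + [g, g] is an orthogonal  *)
(* sum with semisimple second factor, and dim c is the dimension of the span of *)
(* X^1 and Z^2 modulo h.  Z^2 is never in h + <X^1>, by pairing with the        *)
(* Casimir element; X^1 is in h exactly when n is even.                         *)
From HB Require Import structures.
Require Import Defs.
From mathcomp Require Import all_boot all_order all_algebra.
From mathcomp Require Import reals ring lra zify.
From mathcomp.real_closed Require Import complex mxtens.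

Set Implicit Arguments.
Unset Strict Implicit.
Unset Printing Implicit Defensive.

Import Order.TTheory GRing.Theory Num.Theory.
Local Open Scope ring_scope.

(** * Lie algebras with a definite trace form *)

Section LieAlgebraFacts.
Variables (R : rcfType) (N : nat).
Local Notation T := (cmat R N).
Implicit Types (A B C : T) (g I U V : {vspace T}).

Lemma lie_jacobi A B C : lie A (lie B C) = lie (lie A B) C + lie B (lie A C).
Proof.
rewrite /lie !mulmxBr !mulmxBl !mulmxA.
set a := A *m B *m C; set b := A *m C *m B; set c := B *m C *m A.
set d := C *m B *m A; set e := B *m A *m C; set f := C *m A *m B.
have E (x y z u v w : 'M[R[i]]_N) :
  x - y - (z - u) = x - v - (w - u) + (v - z - (y - w)).
  by rewrite !opprB; apply/matrixP=> i j; rewrite !mxE; ring.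
exact: E.
Qed.

Lemma lieDr A B C : lie A (B + C) = lie A B + lie A C.
Proof. exact: linearD. Qed.

Lemma lieZr a A B : lie A (a *: B) = a *: lie A B.
Proof. exact: linearZ. Qed.

Lemma lie0r A : lie A 0 = 0.
Proof. exact: linear0. Qed.

Lemma lie_sumr A (J : Type) (r : seq J) (F : J -> T) :
  lie A (\sum_(i <- r) F i) = \sum_(i <- r) lie A (F i).
Proof. exact: linear_sum. Qed.

Lemma lieDl A B C : lie (A + B) C = lie A C + lie B C.
Proof. by rewrite lieC lieDr opprD -!lieC. Qed.

Lemma lie_self A : lie A A = 0.
Proof. exact: subrr. Qed.

Lemma lie_span_sub (X : seq T) A U :
  {in X, forall B, lie A B \in U} -> {in <<X>>%VS, forall B, lie A B \in U}.
Proof.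
move=> HX B /(@coord_span _ _ _ (in_tuple X)) ->; rewrite lie_sumr memv_suml //.
by move=> i _; rewrite lieZr memvZ // HX // mem_nth.
Qed.

Definition trform A B : R^o := complex.Re (\tr ((A : 'M[R[i]]_N) *m B)).

Lemma trformC A B : trform A B = trform B A.
Proof. by rewrite /trform mxtrace_mulC. Qed.

Fact trform_is_linear A : linear (trform A).
Proof.
move=> a B C; rewrite /trform cmat_scaleE mulmxDr -scalemxAr linearD linearZ /=.
by case: (\tr _) (\tr _) => [x y] [z t] /=; rewrite mul0r subr0.
Qed.
HB.instance Definition _ A :=
  GRing.isLinear.Build R T R^o *:%R (trform A) (trform_is_linear A).

(** Invariance of the form, from cyclicity of the trace; every orthogonality argument below rests on
    it. *)
Lemma trform_lie A B C : trform (lie A B) C = trform A (lie B C).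
Proof.
rewrite /trform /lie mulmxBl mulmxBr (raddfB mxtrace) [in RHS](raddfB mxtrace).
by rewrite /= !mulmxA -[in LHS](mulmxA B) (mxtrace_mulC B).
Qed.

Lemma lie_prod_ideal g I : lie_ideal g I -> lie_ideal g (lie_prod I I).
Proof.
case/andP=> sIg /lie_prodP idI.
have cII A B : A \in I -> B \in I -> lie A B \in I.
  by move=> AI BI; apply: idI => //; apply: subvP AI.
apply/andP; split; first by apply/lie_prodP=> A B AI BI; apply/(subvP sIg)/cII.
apply/lie_prodP=> A B Ag; apply/lie_span_sub: B => _ /allpairsP[[B C] [/= BI CI ->]].
have {}BI := vbasis_mem BI; have {}CI := vbasis_mem CI.
by rewrite lie_jacobi memvD // mem_lie_prod ?idI.
Qed.

(** By the Jacobi identity the elements whose bracket maps [U] into itself form a subalgebra, so it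
    is enough to test generators. *)
Lemma lie_gen_stable (X : seq T) U :
    {in X, forall A, {in U, forall B, lie A B \in U}} ->
  {in lie_gen X, forall A, {in U, forall B, lie A B \in U}}.
Proof.
(* [W] is the stabilizer of [U], written as a finite intersection of preimages so that it is a
   subspace by construction. *)
move=> XU; pose W := (\bigcap_(i < \dim U) (linfun (lie (vbasis U)`_i) @^-1: U))%VS.
have memW A : reflect {in U, forall B, lie A B \in U} (A \in W).
  rewrite memvE; apply: (iffP subv_bigcapP) => [AW B /coord_vbasis-> | AU i _].
    rewrite lie_sumr memv_suml // => i _; rewrite lieZr memvZ // lieC memvN.
    by have := AW i isT; rewrite -memvE -memv_preim lfunE.
  rewrite -memvE -memv_preim lfunE /= lieC memvN AU // vbasis_mem // memt_nth //.
suff /subvP sXW : (lie_gen X <= W)%VS by move=> A /sXW/memW.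
apply: lie_gen_min => [A /XU/memW //|]; apply/lie_prodP => A B /memW AU /memW BU.
apply/memW => C CU; rewrite -[lie (lie A B) C](addrK (lie B (lie A C))) -lie_jacobi.
by rewrite memvB // ?BU ?AU // BU.
Qed.

(** Modulo the ideal [U] the generators commute, so the quotient is abelian and spanned by their
    images. *)
Lemma lie_gen2_derived (x y : T) U :
    {in U, forall A, lie x A \in U} -> {in U, forall A, lie y A \in U} ->
    lie x y \in U -> (U <= lie_gen [:: x; y])%VS ->
  lie_gen [:: x; y] = (<<[:: x; y]>> + U)%VS /\
  (lie_prod (lie_gen [:: x; y]) (lie_gen [:: x; y]) <= U)%VS.
Proof.
move=> xU yU xyU sUg; set g := lie_gen _ in sUg *; set W := (_ + U)%VS.
have gU : {in g, forall A, {in U, forall B, lie A B \in U}}.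
  by apply: lie_gen_stable => A; rewrite !inE => /orP[]/eqP->.
have WU A B : A \in W -> B \in W -> lie A B \in U.
  case/memv_addP=> A1 A1x [A2 A2U ->] /memv_addP[B1 B1x [B2 B2U ->]].
  have sg C : C \in <<[:: x; y]>>%VS -> C \in g by apply: (subvP (sub_lie_gen _)).
  have E12 : lie A1 B2 \in U by apply: gU => //; apply: sg.
  have E21 : lie A2 B1 \in U by rewrite lieC memvN; apply: gU => //; apply: sg.
  have E22 : lie A2 B2 \in U by apply: gU => //; apply: (subvP sUg).
  rewrite lieDl !lieDr; apply: memvD; last exact: memvD.
  apply: memvD => //.
  apply: (lie_span_sub _ B1x) => B'; rewrite !inE => BX; rewrite lieC memvN.
  apply: (lie_span_sub _ A1x) => A'; rewrite !inE => /orP[]/eqP->;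
    by case/orP: BX => /eqP->; rewrite ?lie_self ?mem0v // lieC memvN.
have sWg : (W <= g)%VS by rewrite subv_add sub_lie_gen.
have sgW : (g <= W)%VS.
  apply: lie_gen_min => [A Ax|]; first by rewrite (subvP (addvSl _ _)) ?memv_span.
  by apply/lie_prodP => A B AW BW; rewrite (subvP (addvSr _ _)) ?WU.
have -> : g = W by apply/eqP; rewrite eqEsubv sgW.
by split=> //; apply/lie_prodP.
Qed.

Section Definite.
Variable g : {vspace T}.
Hypothesis g_lie : lie_subalg g.
(* Holds for skew-Hermitian matrices, where the form is negative definite. *)
Hypothesis def_g : forall A, A \in g -> trform A A = 0 -> A = 0.
Let c := lie_center g.
Let s := lie_prod g g.

Let mem_lie A B : A \in g -> B \in g -> lie A B \in g.
Proof. by move=> Ag Bg; apply: (lie_prodP _ _ _ g_lie). Qed.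

Let mem_s A : A \in s -> A \in g.
Proof. exact: (subvP g_lie). Qed.

(** By invariance ([A,B], [A,B]) = (A, [B,[A,B]]) = 0, and definiteness gives [A,B] = 0. *)
Lemma lie_center_orth A :
  A \in g -> (forall B, B \in s -> trform A B = 0) -> A \in c.
Proof.
move=> Ag As; apply/lie_centerP; split=> // B Bg; apply: def_g; first exact: mem_lie.
by rewrite trform_lie As // mem_lie_prod // mem_lie // mem_lie.
Qed.

(** The center is orthogonal to all brackets, since (A, [B,C]) = ([A,B], C) = 0; an element of both
    spaces is thus orthogonal to itself. *)
Lemma lie_center_derived_disjoint : (c :&: s)%VS = 0%VS.
Proof.
apply/eqP; rewrite -subv0; apply/subvP=> A; rewrite memv_cap => /andP[Ac As].
have [Ag cA] := lie_centerP _ _ Ac; rewrite memv0; apply/eqP/def_g => //.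
suff /subvP/(_ A As) : (s <= lker (linfun (trform A)))%VS.
  by rewrite memv_ker lfunE => /eqP.
apply/lie_prodP => B C Bg Cg.
by rewrite memv_ker lfunE /= -trform_lie cA // trformC linear0.
Qed.

Lemma lie_center_derived : g = (c + s)%VS.
Proof.
(* Pairing with a basis of [s] has rank at most \dim s, and its kernel in [g] is central; so \dim g
   is at most \dim c + \dim s. *)
pose f A : 'rV[R]_(\dim s) := \row_i trform A (vbasis s)`_i.
have lin_f : linear f.
  by move=> a A B; apply/rowP=> i; rewrite !mxE !(trformC _ (vbasis s)`_i) linearP.
pose F := HB.pack_for {linear T -> 'rV[R]_(\dim s)} f (GRing.isLinear.Build _ _ _ _ f lin_f).
apply/esym/eqP; rewrite eqEdim subv_add (g_lie : (s <= g)%VS) capvSl /=.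
rewrite (dimv_disjoint_sum lie_center_derived_disjoint) -(limg_ker_dim (linfun F) g).
apply: leq_add; last first.
  by apply: leq_trans (dimvS (subvf _)) _; rewrite dimvf /dim /= mul1n.
apply/dimvS/subvP=> A; rewrite memv_cap memv_ker lfunE => /andP[Ag /eqP/rowP fA].
apply: lie_center_orth => // B /coord_vbasis->; rewrite linear_sum big1 // => i _.
by rewrite linearZ /=; have := fA i; rewrite !mxE => ->; rewrite scaler0.
Qed.

(** Induction on the derived length leaves an abelian ideal I of [s]. For A in I and B in [s],
    ([A,B], [A,B]) = ([[A,B],A], B) = 0 because [A,B] is in I again. So A commutes with [s] and with
    the center, hence is central in [g], and it lies in [s]. *)
Lemma lie_derived_semisimple : lie_semisimple s.
Proof.
move=> I idI [k]; elim: k I idI => [|k IHk] I idI // I0.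
have {}I0 : lie_prod I I = 0%VS.
  by apply: IHk; [apply: lie_prod_ideal | rewrite -iterSr].
have /andP[sIs /lie_prodP sI] := idI.
apply/eqP; rewrite -subv0; apply/subvP=> A AI.
have As := subvP sIs A AI; have Ag := mem_s As.
have cAs B : B \in s -> lie A B = 0.
  move=> Bs; apply: def_g; first exact: mem_lie (mem_s Bs).
  rewrite -trform_lie; suff -> : lie (lie A B) A = 0 by rewrite trformC linear0.
  by apply/eqP; rewrite -memv0 -I0 mem_lie_prod // lieC memvN sI.
rewrite -lie_center_derived_disjoint memv_cap As andbT; apply/lie_centerP; split=> //.
move=> B; rewrite lie_center_derived => /memv_addP[C Cc [D Ds ->]].
by rewrite lieDr (cAs D Ds) addr0 lieC (lie_centerP _ _ Cc).2 ?oppr0.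
Qed.

End Definite.
End LieAlgebraFacts.

(** * Pauli strings *)

Section PauliStrings.
Variable R : rcfType.
Local Open Scope complex_scope.
Local Notation C := R[i].
Local Notation letter := (bool * bool)%type.

Lemma tensmxZ m n p q a b (A : 'M[C]_(m, n)) (B : 'M[C]_(p, q)) :
  (a *: A) *t (b *: B) = (a * b) *: (A *t B).
Proof. by apply/matrixP=> i j; rewrite !mxE mulrACA. Qed.

Lemma mxtrace_tens m n (A : 'M[C]_m) (B : 'M[C]_n) : \tr (A *t B) = \tr A * \tr B.
Proof. by rewrite /mxtrace mulr_sum; apply: eq_bigr => i _; rewrite !mxE. Qed.

Lemma tensmx1 m n : 1%:M *t 1%:M = 1%:M :> 'M[C]_(m * n).
Proof.
apply/matrixP=> i j; rewrite -(mxtens_unindexK i) -(mxtens_unindexK j).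
case: (mxtens_unindex i) (mxtens_unindex j) => [i0 i1] [j0 j1].
have E : (mxtens_index (i0, i1) == mxtens_index (j0, j1)) = ((i0, i1) == (j0, j1)).
  exact/can_eq/mxtens_indexK.
rewrite tensmxE !mxE E -pair_eqE /=.
by case: eqP; case: eqP; rewrite ?mulr0 ?mul0r ?mulr1.
Qed.

Lemma eq_bigtens n (A B : 'I_n -> 'M[C]_2) : A =1 B -> bigtens A = bigtens B.
Proof.
case: n A B => // k; elim: k => [|k IHk] A B eqAB /=; first exact: eqAB.
by rewrite eqAB; congr (_ *t _); apply: IHk => j; apply: eqAB.
Qed.

Lemma bigtensM n (A B : 'I_n -> 'M[C]_2) :
  bigtens A *m bigtens B = bigtens (fun j => A j *m B j).
Proof.
case: n A B => [|k] A B; first by rewrite mul1mx.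
elim: k A B => [|k IHk] A B //=; apply: etrans (tensmx_mul _ _ _ _) _.
by congr (_ *t _); apply: IHk.
Qed.

Lemma bigtensZ n c (A : 'I_n -> 'M[C]_2) :
  bigtens (fun j => c j *: A j) = (\prod_j c j) *: bigtens A.
Proof.
case: n c A => [|k] c A; first by rewrite big_ord0 scale1r.
elim: k c A => [|k IHk] c A /=; first by rewrite big_ord_recl big_ord0 mulr1.
rewrite big_ord_recl -tensmxZ; congr (_ *t _).
exact: IHk (fun j => c (lift ord0 j)) (fun j => A (lift ord0 j)).
Qed.

Lemma bigtens1 n : bigtens (fun _ : 'I_n => 1%:M) = 1%:M :> 'M[C]_(2 ^ n).
Proof.
case: n => // k; elim: k => //= k IHk.
by rewrite [X in _ *t X]IHk; apply: tensmx1.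
Qed.

Lemma mxtrace_bigtens n (A : 'I_n -> 'M[C]_2) : \tr (bigtens A) = \prod_j \tr (A j).
Proof.
case: n A => [|k] A; first by rewrite big_ord0 mxtrace1.
elim: k A => [|k IHk] A /=; first by rewrite big_ord_recl big_ord0 mulr1.
by rewrite big_ord_recl (@mxtrace_tens 2) IHk.
Qed.

(* The letter (x, z) stands for the Pauli matrix with X-part x and Z-part z,  *)
(* so that (true, true) is Y.                                                 *)
Definition pauli (a : letter) : 'M[C]_2 :=
  if a.1 then if a.2 then pauliY R else pauliX R else if a.2 then pauliZ R else 1%:M.

Definition flipx (a : letter) : letter := (~~ a.1, a.2).
Definition flipz (a : letter) : letter := (a.1, ~~ a.2).
(** Phases produced when a letter is multiplied by X or Z; the prefixes l and r tell on which side
    the factor X or Z stands. *)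
Definition lphx (a : letter) : C := if a.2 then if a.1 then 'i%C else - 'i%C else 1.
Definition rphx (a : letter) : C := if a.2 then if a.1 then - 'i%C else 'i%C else 1.
Definition lphz (a : letter) : C := if a.1 then if a.2 then - 'i%C else 'i%C else 1.
Definition rphz (a : letter) : C := if a.1 then if a.2 then 'i%C else - 'i%C else 1.

Lemma flipxK : involutive flipx. Proof. by case=> [[] []]. Qed.
Lemma flipzK : involutive flipz. Proof. by case=> [[] []]. Qed.

Let ord2P (P : 'I_2 -> Prop) : P ord0 -> P (lift ord0 ord0) -> forall i, P i.
Proof.
move=> P0 P1 [[|[|//]] i2]; first by rewrite (_ : Ordinal _ = ord0) //; apply: val_inj.
by rewrite (_ : Ordinal _ = lift ord0 ord0) //; apply: val_inj.
Qed.

Ltac pauli_mx :=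
  case=> [[] []]; apply/matrixP; apply: ord2P; apply: ord2P;
  rewrite ?(mxE, big_ord_recl, big_ord0) /pauli /pauliX /pauliY /pauliZ /lphx /rphx /lphz /rphz /=
    ?(mxE, big_ord_recl, big_ord0) /=; apply/eqP; rewrite eq_complex /=;
  apply/andP; split; apply/eqP; ring.

Lemma pauliX_mul a : pauliX R *m pauli a = lphx a *: pauli (flipx a).
Proof. move: a; pauli_mx. Qed.
Lemma mul_pauliX a : pauli a *m pauliX R = rphx a *: pauli (flipx a).
Proof. move: a; pauli_mx. Qed.
Lemma pauliZ_mul a : pauliZ R *m pauli a = lphz a *: pauli (flipz a).
Proof. move: a; pauli_mx. Qed.
Lemma mul_pauliZ a : pauli a *m pauliZ R = rphz a *: pauli (flipz a).
Proof. move: a; pauli_mx. Qed.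

Lemma mxtrace_pauli a b : \tr (pauli a *m pauli b) = (2 * (a == b))%:R.
Proof.
case: a b => [[] []] [[] []]; rewrite /mxtrace ?(mxE, big_ord_recl, big_ord0)
  /pauli /pauliX /pauliY /pauliZ /= ?(mxE, big_ord_recl, big_ord0) /=;
  apply/eqP; rewrite eq_complex /=; apply/andP; split; apply/eqP; ring.
Qed.

Section Strings.
Variable n : nat.
Local Notation string := {ffun 'I_n -> letter}.
Implicit Types (f : string) (j : 'I_n) (d : nat -> nat -> nat -> C).

Definition pauli_string f : 'M[C]_(2 ^ n) := bigtens (fun j => pauli (f j)).

Definition upd f j v : string := [ffun k => if k == j then v else f k].

Definition cnt (l : letter) f := #|[set j | f j == l]|.
Local Notation cI := (cnt (false, false)).
Local Notation cX := (cnt (true, false)).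
Local Notation cY := (cnt (true, true)).
Local Notation cZ := (cnt (false, true)).

Lemma cntE l f : cnt l f = (\sum_j (f j == l))%N.
Proof. by rewrite /cnt -sum1dep_card big_mkcond; apply: eq_bigr => j _; case: eqP. Qed.

Lemma cnt_upd l f j v : cnt l (upd f j v) = (cnt l f - (f j == l) + (v == l))%N.
Proof.
rewrite !cntE (bigD1 j) //= [in RHS](bigD1 j) //= ffunE eqxx addKn addnC; congr (_ + _)%N.
by apply: eq_bigr => k /negPf nk; rewrite ffunE nk.
Qed.

Lemma sum_letters f (H : letter -> C) :
  \sum_j H (f j) = (cI f)%:R * H (false, false) + (cX f)%:R * H (true, false)
                 + (cY f)%:R * H (true, true) + (cZ f)%:R * H (false, true).
Proof.
rewrite !cntE !natr_sum !mulr_suml -!big_split /=; apply: eq_bigr => j _.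
by case: (f j) => [[] []] /=; ring.
Qed.

Lemma cnt_total f : (cI f + cX f + cY f + cZ f)%N = n.
Proof.
rewrite !cntE -!big_split /= -[RHS]card_ord -sum1_card; apply: eq_bigr => j _.
by case: (f j) => [[] []].
Qed.

Lemma upd_flipK (flip : letter -> letter) j :
  involutive flip -> involutive (fun f => upd f j (flip (f j))).
Proof.
by move=> flipK f; apply/ffunP=> k; rewrite !ffunE eqxx flipK; case: eqP => // ->.
Qed.

Lemma on_qubit_mul (S : 'M[C]_2) flip (ph : letter -> C) j f :
  (forall a, S *m pauli a = ph a *: pauli (flip a)) ->
  on_qubit S j *m pauli_string f = ph (f j) *: pauli_string (upd f j (flip (f j))).
Proof.
move=> Sa; rewrite bigtensM.
rewrite (@eq_bigtens _ _ (fun k => (if k == j then ph (f j) else 1)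
    *: pauli (upd f j (flip (f j)) k))) => [|k].
  by rewrite bigtensZ (bigD1 j) //= eqxx big1 ?mulr1 // => k /negPf ->.
by rewrite ffunE; case: eqP => [->|_]; rewrite ?Sa // mul1mx scale1r.
Qed.

Lemma mul_on_qubit (S : 'M[C]_2) flip (ph : letter -> C) j f :
  (forall a, pauli a *m S = ph a *: pauli (flip a)) ->
  pauli_string f *m on_qubit S j = ph (f j) *: pauli_string (upd f j (flip (f j))).
Proof.
move=> Sa; rewrite bigtensM.
rewrite (@eq_bigtens _ _ (fun k => (if k == j then ph (f j) else 1)
    *: pauli (upd f j (flip (f j)) k))) => [|k].
  by rewrite bigtensZ (bigD1 j) //= eqxx big1 ?mulr1 // => k /negPf ->.
by rewrite ffunE; case: eqP => [->|_]; rewrite ?Sa // mulmx1 scale1r.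
Qed.

Definition wsum d : 'M[C]_(2 ^ n) :=
  \sum_f d (cX f) (cY f) (cZ f) *: pauli_string f.

Lemma eq_wsum d1 d2 :
  (forall p q r, (p + q + r <= n)%N -> d1 p q r = d2 p q r) -> wsum d1 = wsum d2.
Proof.
move=> eq_d; apply: eq_bigr => f _; rewrite eq_d //.
by rewrite -(cnt_total f) -!addnA leq_addl.
Qed.

(** Coefficient of an output string with counts p, q, r after a one-site operation summed over all
    sites: a site with output letter l had input letter [flip l], which shifts the counts. Truncated
    subtraction is harmless, because the multiplicity of l vanishes with its count. *)
Definition flipact (flip : letter -> letter) (ph : letter -> C) d : nat -> nat -> nat -> C :=
  fun p q r =>
  let H l := ph (flip l) * d (p - (l == (true, false)) + (flip l == (true, false)))%N
    (q - (l == (true, true)) + (flip l == (true, true)))%N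
    (r - (l == (false, true)) + (flip l == (false, true)))%N in
  (n - p - q - r)%:R * H (false, false) + p%:R * H (true, false)
    + q%:R * H (true, true) + r%:R * H (false, true).

Lemma wsum_flipact (S : 'I_n -> 'M[C]_(2 ^ n) -> 'M[C]_(2 ^ n)) flip ph d :
  involutive flip -> (forall j, linear (S j)) ->
  (forall j f, S j (pauli_string f) = ph (f j) *: pauli_string (upd f j (flip (f j)))) ->
  \sum_j S j (wsum d) = wsum (flipact flip ph d).
Proof.
move=> flipK linS Sf.
have SE j : S j (wsum d) = \sum_(f : string) (ph (flip (f j)) * d (cX (upd f j (flip (f j))))
    (cY (upd f j (flip (f j)))) (cZ (upd f j (flip (f j))))) *: pauli_string f.
  pose L := HB.pack_for {linear 'M[C]_(2 ^ n) -> 'M[C]_(2 ^ n)} (S j)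
    (GRing.isLinear.Build _ _ _ _ (S j) (linS j)).
  rewrite -[S j _]/(L _) (linear_sum L) (reindex_inj (inv_inj (upd_flipK j flipK))).
  apply: eq_bigr => f _.
  by rewrite (linearZZ L) [L _]Sf scalerA (upd_flipK j flipK f) ffunE eqxx mulrC.
under eq_bigr do rewrite SE; rewrite exchange_big /=; apply: eq_bigr => f _.
rewrite -scaler_suml; congr (_ *: _).
under eq_bigr do rewrite !cnt_upd.
rewrite (sum_letters f (fun l => ph (flip l) * d (cX f - (l == (true, false)) + (flip l == (true, false)))%N
    (cY f - (l == (true, true)) + (flip l == (true, true)))%N
    (cZ f - (l == (false, true)) + (flip l == (false, true)))%N)).
suff -> : cI f = (n - cX f - cY f - cZ f)%N by [].
by have := cnt_total f; lia.
Qed.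

Definition sumX := \sum_j on_qubit (pauliX R) j : 'M[C]_(2 ^ n).
Definition sumZ := \sum_j on_qubit (pauliZ R) j : 'M[C]_(2 ^ n).

Lemma sumX_mul d : sumX *m wsum d = wsum (flipact flipx lphx d).
Proof.
rewrite mulmx_suml; apply: (wsum_flipact (S := fun j => mulmx (on_qubit (pauliX R) j))) flipxK _ _.
  by move=> j a A B; rewrite linearP.
by move=> j f; apply: on_qubit_mul pauliX_mul.
Qed.

Lemma mul_sumX d : wsum d *m sumX = wsum (flipact flipx rphx d).
Proof.
rewrite mulmx_sumr; apply: (wsum_flipact (S := fun j => mulmxr (on_qubit (pauliX R) j))) flipxK _ _.
  by move=> j a A B; rewrite linearP.
by move=> j f; apply: mul_on_qubit mul_pauliX.
Qed.

Lemma sumZ_mul d : sumZ *m wsum d = wsum (flipact flipz lphz d).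
Proof.
rewrite mulmx_suml; apply: (wsum_flipact (S := fun j => mulmx (on_qubit (pauliZ R) j))) flipzK _ _.
  by move=> j a A B; rewrite linearP.
by move=> j f; apply: on_qubit_mul pauliZ_mul.
Qed.

Lemma mul_sumZ d : wsum d *m sumZ = wsum (flipact flipz rphz d).
Proof.
rewrite mulmx_sumr; apply: (wsum_flipact (S := fun j => mulmxr (on_qubit (pauliZ R) j))) flipzK _ _.
  by move=> j a A B; rewrite linearP.
by move=> j f; apply: mul_on_qubit mul_pauliZ.
Qed.

Lemma wsumB d1 d2 : wsum d1 - wsum d2 = wsum (fun p q r => d1 p q r - d2 p q r).
Proof. by rewrite -sumrB; apply: eq_bigr => f _; rewrite -scalerBl. Qed.

Lemma wsumD d1 d2 : wsum d1 + wsum d2 = wsum (fun p q r => d1 p q r + d2 p q r).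
Proof. by rewrite -big_split; apply: eq_bigr => f _ /=; rewrite -scalerDl. Qed.

Lemma wsumZ a d : a *: wsum d = wsum (fun p q r => a * d p q r).
Proof. by rewrite scaler_sumr; apply: eq_bigr => f _; rewrite scalerA. Qed.

Lemma sumX_comm d : sumX *m wsum d - wsum d *m sumX =
  wsum (fun p q r => 2 * 'i%C * (r%:R * d p q.+1 r.-1 - q%:R * d p q.-1 r.+1)).
Proof.
rewrite sumX_mul mul_sumX wsumB; apply: eq_wsum => p q r _.
rewrite /flipact /flipx /lphx /rphx /= !addn0 !subn0 !subn1 !addn1 /=.
by ring.
Qed.

Lemma sumZ_comm d : sumZ *m wsum d - wsum d *m sumZ =
  wsum (fun p q r => 2 * 'i%C * (q%:R * d p.+1 q.-1 r - p%:R * d p.-1 q.+1 r)).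
Proof.
rewrite sumZ_mul mul_sumZ wsumB; apply: eq_wsum => p q r _.
rewrite /flipact /flipz /lphz /rphz /= !addn0 !subn0 !subn1 !addn1 /=.
by ring.
Qed.

Lemma sumZ_anticomm d : sumZ *m wsum d + wsum d *m sumZ =
  wsum (fun p q r => 2 * (r%:R * d p q r.-1 + (n - p - q - r)%:R * d p q r.+1)).
Proof.
rewrite sumZ_mul mul_sumZ wsumD; apply: eq_wsum => p q r _.
rewrite /flipact /flipz /lphz /rphz /= !addn0 !subn0 !subn1 !addn1 /=.
by ring.
Qed.

End Strings.
End PauliStrings.

(** * Permutation-invariant matrices by their coefficients *)

Section SymmetricMatrices.
Variables (R : rcfType) (n : nat).
Local Open Scope complex_scope.
Local Notation C := R[i].
Local Notation letter := (bool * bool)%type.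
Local Notation string := {ffun 'I_n -> letter}.
Local Notation cX := (cnt (true, false)).
Local Notation cY := (cnt (true, true)).
Local Notation cZ := (cnt (false, true)).
Local Notation T := (cmat R (2 ^ n)).
Local Notation coefs := (nat -> nat -> nat -> R).
Implicit Types (c a b : coefs) (f g : string).

Lemma on_qubit_comm (A B : 'M[C]_2) (j k : 'I_n) :
  j != k -> on_qubit A j *m on_qubit B k = on_qubit B k *m on_qubit A j.
Proof.
move=> njk; rewrite !bigtensM; apply: eq_bigtens => l.
by case: (l =P j) => [->|_]; rewrite ?(negPf njk) ?mulmx1 ?mul1mx.
Qed.

Lemma on_qubit_sqr (A : 'M[C]_2) (j : 'I_n) :
  A *m A = 1%:M -> on_qubit A j *m on_qubit A j = 1%:M.
Proof.
move=> AA; rewrite bigtensM -(bigtens1 R n); apply: eq_bigtens => k.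
by case: eqP; rewrite ?mulmx1.
Qed.

Lemma on_qubitsE (P : 'M[C]_2) (A : {set 'I_n}) :
  on_qubits P A = bigtens (fun j => if j \in A then P else 1%:M).
Proof.
rewrite /on_qubits -big_filter.
rewrite (@eq_bigtens _ _ _ (fun j => if j \in [seq k <- index_enum 'I_n | k \in A] then P else 1%:M)); last first.
  by move=> j; rewrite mem_filter mem_index_enum andbT.
have := filter_uniq (mem A) (index_enum_uniq 'I_n).
elim: [seq _ <- _ | _] => [|j s IHs] /=; first by rewrite big_nil bigtens1.
case/andP=> js us; rewrite big_cons IHs // bigtensM; apply: eq_bigtens => k.
rewrite inE; case: eqP => [->|_]; last by rewrite mul1mx.
by rewrite (negPf js) mulmx1.
Qed.

Lemma mxtrace_pauli_string f g :
  \tr (pauli_string R f *m pauli_string R g) = (2 ^ n * (f == g))%:R.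
Proof.
rewrite bigtensM mxtrace_bigtens; under eq_bigr do rewrite mxtrace_pauli.
rewrite -natr_prod big_split prod_nat_const card_ord /=; congr (_ * _)%:R.
case: eqP => [-> | /eqP nfg]; first by rewrite big1 // => j _; rewrite eqxx.
have [j nj] : exists j, f j != g j.
  by apply/existsP; apply: contraR nfg; rewrite negb_exists => /forallP fg;
    apply/eqP/ffunP=> j; apply/eqP; have := fg j; rewrite negbK.
by rewrite (bigD1 j) //= (negPf nj).
Qed.

Lemma eq_iscale (A B : 'M[C]_(2 ^ n)) : A = B -> 'i%C *: A = 'i%C *: B.
Proof. by move->. Qed.

(* Permutation-invariant matrices are recorded by their coefficients on the   *)
(* elements [XYZ p q r].                                                      *)
Definition mat c : T := 'i%C *: wsum n (fun p q r => (c p q r)%:C).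

Lemma eq_mat a b :
  (forall p q r, (p + q + r <= n)%N -> a p q r = b p q r) -> mat a = mat b.
Proof. by move=> eqab; rewrite /mat; apply: eq_iscale; apply: eq_wsum => p q r /eqab->. Qed.

Lemma matD a b : mat a + mat b = mat (fun p q r => a p q r + b p q r).
Proof.
transitivity ('i%C *: (wsum n (fun p q r => (a p q r)%:C) + wsum n (fun p q r => (b p q r)%:C))).
  by rewrite scalerDr.
rewrite wsumD; apply: eq_iscale.
by apply: eq_wsum => p q r _; rewrite rmorphD.
Qed.

Lemma matZ (k : R) c : k *: mat c = mat (fun p q r => k * c p q r).
Proof.
apply: etrans (_ : 'i%C *: (k%:C *: wsum n (fun p q r => (c p q r)%:C)) = _).
  by rewrite cmat_scaleE /mat !scalerA mulrC.
apply: eq_iscale; rewrite wsumZ.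
by apply: eq_wsum => p q r _; rewrite rmorphM.
Qed.

Lemma mat0 : mat (fun _ _ _ => 0) = 0.
Proof. by rewrite /mat /wsum big1 ?scaler0 // => f _; rewrite scale0r. Qed.

Definition delta (p q r : nat) : coefs := fun p' q' r' => [&& p' == p, q' == q & r' == r]%:R.

Definition tripart f := ([set j | f j == (true, false)], [set j | f j == (true, true)],
  [set j | f j == (false, true)]).

Definition untripart (t : {set 'I_n} * {set 'I_n} * {set 'I_n}) : string :=
  [ffun j => if j \in t.1.1 then (true, false) else if j \in t.1.2 then (true, true)
             else (false, j \in t.2)].

Lemma tripartK : cancel tripart untripart.
Proof.
by move=> f; apply/ffunP=> j; rewrite ffunE /= !inE; case: (f j) => [[] []].
Qed.

(** Disjoint triples of sets correspond to strings through [tripart]; disjointness is what makes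
    [untripart] invert it on the other side. *)
Lemma XYZ_mat p q r : XYZ R n p q r = mat (delta p q r).
Proof.
rewrite /XYZ /mat; apply: eq_iscale; rewrite (reindex_onto tripart untripart) /=; last first.
  move=> [[A B] D] /and5P[_ _ _ dAB /andP[dAD dBD]].
  congr (_, _, _); apply/setP=> j; rewrite inE ffunE /=;
    have := @disjointFr _ _ _ j dAB;
    have := @disjointFr _ _ _ j dAD; have := @disjointFr _ _ _ j dBD;
    case: (j \in A); case: (j \in B); case: (j \in D) => //= h1 h2 h3;
    by [have := h1 isT | have := h2 isT | have := h3 isT].
rewrite /wsum [RHS](bigID (fun f => [&& cX f == p, cY f == q & cZ f == r])) /=.
rewrite [X in _ = _ + X]big1 ?addr0; last by move=> f /negPf nf; rewrite /delta nf scale0r.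
apply: eq_big => [f | f].
  rewrite tripartK eqxx andbT -[RHS]andbT -!andbA; do 3!congr (_ && _); apply/and3P; split;
    rewrite disjoints_subset; apply/subsetP=> j; rewrite !inE => /eqP->; by [].
rewrite -!andbA => /and4P[cXf cYf cZf _]; rewrite /delta [cX f == p]cXf [cY f == q]cYf [cZ f == r]cZf scale1r.
rewrite !on_qubitsE !bigtensM; apply: eq_bigtens => j; rewrite !inE /pauli.
by case: (f j) => [[] []]; rewrite /= ?mul1mx ?mulmx1.
Qed.

Lemma wsum1 : wsum n (fun p q r => (delta 0 0 0 p q r)%:C) = 1%:M.
Proof.
apply: (@scalerI _ _ 'i%C); first by rewrite eq_complex negb_and /= oner_eq0 orbT.
transitivity (XYZ R n 0 0 0 : 'M[C]_(2 ^ n)); first by rewrite XYZ_mat.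
apply: eq_iscale.
rewrite (big_pred1 (set0, set0, set0)) => [|[[A B] D]].
  by rewrite !on_qubitsE !bigtensM -(bigtens1 R n); apply: eq_bigtens => j; rewrite !inE !mul1mx.
rewrite /= !cards_eq0 -!pair_eqE /= -!andbA.
case: eqP => [->|] //=; case: eqP => [->|] //=; case: eqP => [->|] //=.
by rewrite -!setI_eq0 !set0I eqxx.
Qed.

Lemma mixerE : mixer R n = XYZ R n 1 0 0.
Proof.
rewrite XYZ_mat /mixer /mat -/(sumX R n) -[sumX R n]mulmx1 -wsum1 sumX_mul.
apply: eq_iscale; apply: eq_wsum => p q r _; rewrite /flipact /lphx /flipx /delta /=.
rewrite !addn0 !subn0 !subn1 !addn1 /= !andbF.
by case: p => [|p]; rewrite /= ?rmorph0 ?mulr0 ?mul0r ?addr0 ?add0r // eqSS;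
  case: eqP => [->|_]; rewrite /= ?rmorph0 ?mulr0 ?mul1r.
Qed.

Lemma sumZ_sqr : sumZ R n *m sumZ R n =
  n%:R%:M + 2 *: \sum_(j < n) \sum_(k < n | (j < k)%N) on_qubit (pauliZ R) j *m on_qubit (pauliZ R) k.
Proof.
pose z j k := on_qubit (pauliZ R) j *m on_qubit (pauliZ R) k : 'M[C]_(2 ^ n).
rewrite mulmx_suml; under eq_bigr do rewrite mulmx_sumr.
rewrite (eq_bigr (fun j : 'I_n => \sum_(k < n | (j < k)%N) z j k + (z j j + \sum_(k < n | (k < j)%N) z j k))).
  rewrite !big_split /= addrCA scaler_nat mulr2n; congr (_ + (_ + _)).
    rewrite (eq_bigr (fun=> 1%:M)); last first.
      by move=> j _; apply/on_qubit_sqr/(etrans (pauliZ_mul R (false, true)))/scale1r.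
    by rewrite sumr_const card_ord -raddfMn.
  rewrite (exchange_big_dep predT) //=; apply: eq_bigr => j _; apply: eq_bigr => k jk.
  by apply: on_qubit_comm; rewrite neq_ltn jk orbT.
move=> j _; rewrite (bigID (fun k : 'I_n => (j < k)%N)) /=; congr (_ + _).
rewrite (bigD1 j) ?ltnn //=; congr (_ + _); apply: eq_bigl => k.
by rewrite -leqNgt ltn_neqAle andbC.
Qed.

(** The square of the sum of the Z_j is computed twice: by [sumZ_sqr], and by letting that sum act
    twice on the identity through [flipact]. *)
Lemma complete_maxcutE : complete_maxcut R n = XYZ R n 0 0 2.
Proof.
rewrite XYZ_mat /complete_maxcut /mat; apply: eq_iscale.
apply: (@scalerI _ _ (2 : C)); first by rewrite pnatr_eq0.
apply: (addrI n%:R%:M); rewrite -sumZ_sqr -[LHS]mulmx1 -mulmxA -[n%:R%:M]scalemx1 -wsum1.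
rewrite !sumZ_mul !wsumZ wsumD.
rewrite (_ : wsum _ _ = wsum n (flipact n flipz (@lphz R) (fun p q r => (delta 0 0 1 p q r)%:C))).
  apply: eq_wsum => p q r _; rewrite /flipact /lphz /flipz /delta /=.
  rewrite !addn0 !subn0 !subn1 !addn1 /= !andbF /=.
  case: p => [|[|p]]; case: q => [|[|q]]; case: r => [|[|[|r]]];
    rewrite /= ?subn0 ?andbF ?rmorph0 ?rmorph1; ring.
apply: eq_wsum => p q r le_n; rewrite /flipact /lphz /flipz /delta /=.
rewrite !addn0 !subn0 !subn1 !addn1 /= !andbF /=.
by case: p le_n => [|[|p]]; case: q => [|[|q]]; case: r => [|[|[|r]]] le_n;
  rewrite /= ?subn0 ?andbF ?rmorph0 ?rmorph1; ring.
Qed.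

Lemma lieX_mat c : lie (XYZ R n 1 0 0) (mat c) =
  mat (fun p q r => 2 * (q%:R * c p q.-1 r.+1 - r%:R * c p q.+1 r.-1)).
Proof.
transitivity (- (sumX R n *m wsum n (fun p q r => (c p q r)%:C) -
    wsum n (fun p q r => (c p q r)%:C) *m sumX R n) : 'M[C]_(2 ^ n)).
  rewrite -mixerE /lie /mixer /mat -/(sumX R n).
  rewrite -!scalemxAl -!scalemxAr !scalerA -expr2 sqr_i !scaleN1r.
  by rewrite opprB opprK addrC.
rewrite sumX_comm -scaleN1r -sqr_i expr2 -scalerA wsumZ; apply: eq_iscale.
apply: eq_wsum => p q r _.
rewrite !(rmorphM, rmorphB, rmorph_nat) /=.
set u := (c p q.+1 r.-1)%:C; set v := (c p q.-1 r.+1)%:C.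
have -> : 'i%C * (2 * 'i%C * (r%:R * u - q%:R * v)) = 'i%C ^+ 2 * (2 * (r%:R * u - q%:R * v)) :> C by ring.
by rewrite sqr_i; ring.
Qed.

Lemma sumZ_sqr_maxcut : 'i%C *: (sumZ R n *m sumZ R n) =
  ('i%C * n%:R)%:M + 2 *: (XYZ R n 0 0 2 : 'M[C]_(2 ^ n)).
Proof.
rewrite sumZ_sqr -complete_maxcutE /complete_maxcut scalerDr scale_scalar_mx.
by congr (_ + _); rewrite !scalerA mulrC.
Qed.

(** With S the sum of the Z_j, Z^2 is i(S^2 - n)/2, and [S^2, w] = S[S,w] + [S,w]S. The commutator
    trades X and Y, the anticommutator moves the exponent of Z by one either way; hence four
    terms. *)
Lemma lieZ_mat c : lie (XYZ R n 0 0 2) (mat c) =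
  mat (fun p q r => 2 *
    (r%:R * (p%:R * c p.-1 q.+1 r.-1 - q%:R * c p.+1 q.-1 r.-1)
     + (n - p - q - r)%:R * (p%:R * c p.-1 q.+1 r.+1 - q%:R * c p.+1 q.-1 r.+1))).
Proof.
set w := wsum n (fun p q r => (c p q r)%:C); set s := sumZ R n.
pose K : 'M[C]_(2 ^ n) := s *m w - w *m s.
have E : 2 *: (lie (XYZ R n 0 0 2) (mat c) : 'M[C]_(2 ^ n)) = - (s *m K + K *m s).
  rewrite /lie scalerBr scalemxAl scalemxAr.
  have -> : 2 *: (XYZ R n 0 0 2 : 'M[C]_(2 ^ n)) = 'i%C *: (s *m s) - ('i%C * n%:R)%:M.
    by rewrite sumZ_sqr_maxcut addrC addKr.
  rewrite /mat -/w mulmxBl mulmxBr -scalar_mxC opprB addrA subrK.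
  rewrite -!scalemxAl -!scalemxAr !scalerA -expr2 sqr_i !scaleN1r /K.
  by rewrite mulmxBr mulmxBl !mulmxA addrA subrK opprB opprK addrC.
apply: (@scalerI C 'M[C]_(2 ^ n) 2); first by rewrite pnatr_eq0.
rewrite E /K sumZ_comm sumZ_anticomm -scaleN1r -sqr_i expr2 -scalerA.
rewrite /mat [RHS]scalerA (mulrC 2 'i%C) -[RHS]scalerA; apply: eq_iscale; rewrite !wsumZ.
apply: eq_wsum => p q r _.
rewrite !(rmorphM, rmorphB, rmorphD, rmorph_nat) /=.
set u1 := (c _ _ _)%:C; set u2 := (c _ _ _)%:C; set u3 := (c _ _ _)%:C; set u4 := (c _ _ _)%:C.
transitivity ('i%C ^+ 2 * (2 * 2 * (r%:R * (q%:R * u1 - p%:R * u2)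
    + (n - p - q - r)%:R * (q%:R * u3 - p%:R * u4)))); first by ring.
by rewrite sqr_i; ring.
Qed.

End SymmetricMatrices.

(** * The trace form on permutation-invariant matrices *)

Section MatTraceForm.
Variables (R : rcfType) (n : nat).
Local Open Scope complex_scope.
Local Notation C := R[i].
Local Notation string := {ffun 'I_n -> (bool * bool)%type}.
Local Notation cX := (cnt (true, false)).
Local Notation cY := (cnt (true, true)).
Local Notation cZ := (cnt (false, true)).
Local Notation coefs := (nat -> nat -> nat -> R).
Implicit Types (c a b : coefs).
Local Notation mat := (mat n).

(** Strings are orthogonal for the trace, each with square trace 2^n; the two factors i give the
    sign. *)
Lemma trform_mat a b : trform (mat a) (mat b) =
  - (2 ^+ n * \sum_(f : string) a (cX f) (cY f) (cZ f) * b (cX f) (cY f) (cZ f)).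
Proof.
rewrite /trform /mat -scalemxAl -scalemxAr scalerA -expr2 sqr_i mulmx_suml.
rewrite (_ : \sum_i _ = \sum_(f : string) \sum_(g : string)
  ((a (cX f) (cY f) (cZ f))%:C * (b (cX g) (cY g) (cZ g))%:C) *: (pauli_string R f *m pauli_string R g)).
  rewrite scaleN1r (raddfN mxtrace) (raddf_sum mxtrace) /=.
  rewrite (eq_bigr (fun f => (2 ^+ n * (a (cX f) (cY f) (cZ f) * b (cX f) (cY f) (cZ f)))%:C)).
    by rewrite -rmorph_sum -mulr_sumr.
  move=> f _; rewrite (raddf_sum mxtrace) (bigD1 f) //= mxtraceZ mxtrace_pauli_string eqxx muln1.
  rewrite big1 ?addr0 => [|g /negPf ngf].
    by rewrite natrX !rmorphM rmorphXn rmorph_nat mulrC.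
  by rewrite mxtraceZ mxtrace_pauli_string eq_sym ngf muln0 mulr0.
apply: eq_bigr => f _; rewrite mulmx_sumr; apply: eq_bigr => g _.
by rewrite -scalemxAl -scalemxAr scalerA.
Qed.

Lemma sum_ltn k m : (\sum_(j < k) (j < m) = minn k m)%N.
Proof.
elim: k => [|k IHk]; first by rewrite big_ord0 min0n.
by rewrite big_ord_recr /= IHk; lia.
Qed.

Lemma string_of_cnt p q r :
  (p + q + r <= n)%N -> exists f : string, [/\ cX f = p, cY f = q & cZ f = r].
Proof.
move=> le_n.
pose f : string := [ffun j : 'I_n => if (j < p)%N then (true, false)
  else if (j < p + q)%N then (true, true) else (false, (j < p + q + r)%N)].
have Xf : cX f = p.
  transitivity (\sum_(j < n) (j < p))%N; last by rewrite sum_ltn; lia.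
  by rewrite cntE; apply: eq_bigr => j _; rewrite ffunE; do 2!case: ltnP.
have XYf : (cX f + cY f = p + q)%N.
  transitivity (\sum_(j < n) (j < p + q))%N; last by rewrite sum_ltn; lia.
  rewrite !cntE -big_split; apply: eq_bigr => j _; rewrite ffunE /=.
  by case: (ltnP j p) => h1; case: (ltnP j (p + q)) => h2 //=; lia.
have XYZf : (cX f + cY f + cZ f = p + q + r)%N.
  transitivity (\sum_(j < n) (j < p + q + r))%N; last by rewrite sum_ltn; lia.
  rewrite !cntE -!big_split; apply: eq_bigr => j _; rewrite ffunE /=.
  by case: (ltnP j p) => h1; case: (ltnP j (p + q)) => h2; case: (ltnP j (p + q + r)) => h3 //=; lia.
by exists f; split=> //; lia.
Qed.

Lemma mat_def0 c : trform (mat c) (mat c) = 0 ->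
  forall p q r, (p + q + r <= n)%N -> c p q r = 0.
Proof.
rewrite trform_mat => /eqP; rewrite oppr_eq0 mulf_eq0 expf_eq0 pnatr_eq0 andbF /=.
rewrite psumr_eq0 => [/allP c0 p q r /string_of_cnt[f [<- <- <-]]|f _].
  by have := c0 f (mem_index_enum f); rewrite mulf_eq0 orbb => /eqP.
by rewrite -expr2 sqr_ge0.
Qed.

End MatTraceForm.

(** * Brackets with the generators *)

Section Brackets.
Variables (R : rcfType) (n : nat).
Local Notation T := (XYZ R n).
Local Notation adX := (lie (T 1 0 0)).
Local Notation adZ := (lie (T 0 0 2)).
Implicit Types p q r : nat.

Lemma XYZ_eq0 p q r : (n < p + q + r)%N -> T p q r = 0.
Proof.
move=> lt_n; rewrite XYZ_mat -mat0; apply: eq_mat => p' q' r' le_n.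
by rewrite /delta; case: and3P => // -[/eqP Ep /eqP Eq /eqP Er]; lia.
Qed.

Lemma adX_XYZ p q r : adX (T p q r) =
  (2 * (q.+1 * (0 < r))%:R) *: T p q.+1 r.-1 - (2 * (r.+1 * (0 < q))%:R) *: T p q.-1 r.+1.
Proof.
rewrite [T p q r]XYZ_mat lieX_mat !XYZ_mat -scaleNr !matZ matD; apply: eq_mat => p' q' r' _.
have E1 : q'%:R * delta R p q r p' q'.-1 r'.+1
    = (q.+1 * (0 < r))%:R * delta R p q.+1 r.-1 p' q' r'.
  rewrite /delta -!natrM; congr _%:R; case: (p' == p); rewrite ?muln0 //=.
  case: q' => [|q']; case: r => [|r]; rewrite ?andbF ?muln0 ?mul0n //= !eqSS.
  by case: eqP => [->|]; rewrite ?muln0 ?muln1.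
have E2 : r'%:R * delta R p q r p' q'.+1 r'.-1
    = (r.+1 * (0 < q))%:R * delta R p q.-1 r.+1 p' q' r'.
  rewrite /delta -!natrM; congr _%:R; case: (p' == p); rewrite ?muln0 //=.
  clear E1; case: r' => [|r']; case: q => [|q]; rewrite ?andbF ?muln0 ?mul0n //= !eqSS.
  by case: (r' =P r) => [->|]; rewrite ?andbF ?muln0 ?muln1.
by rewrite E1 E2; ring.
Qed.

(** The boolean factors remove the terms whose predecessor is truncated. In the last two terms the
    target has p + q + r - 1 letters, so n.+1 - p - q - r is its number of identity sites. *)
Lemma adZ_XYZ p q r : adZ (T p q r) =
  (2 * (r.+1 * p.+1 * (0 < q))%:R) *: T p.+1 q.-1 r.+1
  - (2 * (r.+1 * q.+1 * (0 < p))%:R) *: T p.-1 q.+1 r.+1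
  + (2 * ((n.+1 - p - q - r) * p.+1 * ((0 < q)%N && (0 < r)%N))%:R) *: T p.+1 q.-1 r.-1
  - (2 * ((n.+1 - p - q - r) * q.+1 * ((0 < p)%N && (0 < r)%N))%:R) *: T p.-1 q.+1 r.-1.
Proof.
rewrite [T p q r]XYZ_mat lieZ_mat !XYZ_mat -!scaleNr !matZ !matD; apply: eq_mat => p' q' r' _.
have E1 : r'%:R * (p'%:R * delta R p q r p'.-1 q'.+1 r'.-1)
    = (r.+1 * p.+1 * (0 < q))%:R * delta R p.+1 q.-1 r.+1 p' q' r'.
  rewrite /delta -!natrM; congr _%:R.
  case: p' => [|p']; case: r' => [|r']; case: q => [|q]; rewrite ?andbF ?muln0 ?mul0n //= !eqSS.
  by case: and3P => [[/eqP-> _ /eqP->]|]; rewrite ?muln0 ?muln1.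
have E2 : r'%:R * (q'%:R * delta R p q r p'.+1 q'.-1 r'.-1)
    = (r.+1 * q.+1 * (0 < p))%:R * delta R p.-1 q.+1 r.+1 p' q' r'.
  rewrite /delta -!natrM; congr _%:R; clear E1.
  case: q' => [|q']; case: r' => [|r']; case: p => [|p]; rewrite ?andbF ?muln0 ?mul0n //= !eqSS.
  by case: and3P => [[_ /eqP-> /eqP->]|]; rewrite ?muln0 ?muln1.
have E3 : (n - p' - q' - r')%:R * (p'%:R * delta R p q r p'.-1 q'.+1 r'.+1)
    = ((n.+1 - p - q - r) * p.+1 * ((0 < q)%N && (0 < r)%N))%:R * delta R p.+1 q.-1 r.-1 p' q' r'.
  rewrite /delta -!natrM; congr _%:R; clear E1 E2.
  case: p' => [|p']; case: q => [|q]; case: r => [|r]; rewrite ?andbF ?muln0 ?mul0n //= !eqSS.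
  case: and3P => [[/eqP-> /eqP-> /eqP->]|]; rewrite ?muln0 ?muln1 //; congr (_ * _)%N; lia.
have E4 : (n - p' - q' - r')%:R * (q'%:R * delta R p q r p'.+1 q'.-1 r'.+1)
    = ((n.+1 - p - q - r) * q.+1 * ((0 < p)%N && (0 < r)%N))%:R * delta R p.-1 q.+1 r.-1 p' q' r'.
  rewrite /delta -!natrM; congr _%:R; clear E1 E2 E3.
  case: q' => [|q']; case: p => [|p]; case: r => [|r]; rewrite ?andbF ?muln0 ?mul0n //= !eqSS.
  case: and3P => [[/eqP-> /eqP-> /eqP->]|]; rewrite ?muln0 ?muln1 //; congr (_ * _)%N; lia.
by rewrite !mulrBr E1 E2 E3 E4; ring.
Qed.

End Brackets.

(* Stated for an abstract module and a predicate [U] in place of a subspace,  *)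
(* because conversion checks would otherwise unfold the matrices.             *)
Section LadderRelations.
Variables (R : numFieldType) (V : lmodType R) (n : nat).
Variables (T : nat -> nat -> nat -> V) (adX adZ : {linear V -> V}).
Hypothesis adXE : forall p q r, adX (T p q r) =
  (2 * (q.+1 * (0 < r))%:R) *: T p q.+1 r.-1 - (2 * (r.+1 * (0 < q))%:R) *: T p q.-1 r.+1.
Hypothesis adZE : forall p q r, adZ (T p q r) =
  (2 * (r.+1 * p.+1 * (0 < q))%:R) *: T p.+1 q.-1 r.+1
  - (2 * (r.+1 * q.+1 * (0 < p))%:R) *: T p.-1 q.+1 r.+1
  + (2 * ((n.+1 - p - q - r) * p.+1 * ((0 < q)%N && (0 < r)%N))%:R) *: T p.+1 q.-1 r.-1
  - (2 * ((n.+1 - p - q - r) * q.+1 * ((0 < p)%N && (0 < r)%N))%:R) *: T p.-1 q.+1 r.-1.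
Variable U : V -> Prop.
Hypothesis U0 : U 0.
Hypothesis UD : forall A B, U A -> U B -> U (A + B).
Hypothesis UZ : forall k A, U A -> U (k *: A).

Let UN A : U A -> U (- A). Proof. by rewrite -scaleN1r; apply: UZ. Qed.
Let UB A B : U A -> U B -> U (A - B). Proof. by move=> UA UB; apply/UD/UN. Qed.

Let U_cancel k A B : U (k *: A + B) -> k != 0 -> U B -> U A.
Proof.
move=> UkAB k0 UB'; rewrite -[A]scale1r -(mulVf k0) -scalerA; apply: UZ.
by rewrite -(addrK B (k *: A)); apply: UB.
Qed.

Let nat2_neq0 m : (0 < m)%N -> 2 * m%:R != 0 :> R.
Proof. by case: m => // m _; rewrite -natrM pnatr_eq0. Qed.

Definition odd_in p := forall q r, odd q -> odd r -> U (T p q r).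

(** Each term of a bracket with either generator changes both q and r by one, so even monomials go
    to odd ones. *)
Lemma adX_even p q r : odd_in p -> ~~ odd q -> ~~ odd r -> U (adX (T p q r)).
Proof.
move=> Up; rewrite adXE.
by case: q => [|q]; case: r => [|r] ? ?; rewrite ?muln0 ?mulr0 ?scale0r /=;
  apply: UB => //; apply: UZ; apply: Up; lia.
Qed.

Lemma adZ_even p q r : (forall p', odd_in p') -> ~~ odd q -> ~~ odd r -> U (adZ (T p q r)).
Proof.
move=> Up q_even r_even; rewrite adZE; apply: UB; first apply: UD; first apply: UB;
  case: q q_even => [|q] q_even; case: r r_even => [|r] r_even;
  rewrite ?muln0 ?andbF ?muln0 ?mulr0 ?scale0r //=;
  by apply: UZ; apply: Up; lia.
Qed.

(** Applied with [U] the derived algebra [g, g]. *)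
Section Generated.
Hypothesis adXU : forall A, U A -> U (adX A).
Hypothesis adZU : forall A, U A -> U (adZ A).
Hypothesis YZ_in : U (T 0 1 1).

(** [adZ] sends Y Z^r to X Z^(r+1) and X Z^(r-1), and these back to Y Z^(r+2), Y Z^r and Y Z^(r-2).
    All but the first are known to lie in [U], so the first does. *)
Lemma Y1_odd_in r : odd r -> U (T 0 1 r).
Proof.
have [m] := ubnP r; elim: m r => // m IHm [|[|r]] // lt_rm r_odd.
have {}r_odd : odd r by move: r_odd; rewrite /= negbK.
have Ur : U (T 0 1 r) by apply: IHm => //; lia.
have Z1 : U (adZ (T 1 0 r.-1)).
  rewrite adZE /= ?muln0 ?mulr0 ?scale0r ?sub0r ?addr0; apply: UB.
    by apply/UN/UZ; rewrite prednK //; lia.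
  case: r r_odd lt_rm {Ur} => [|[|r]] // r_odd lt_rm; rewrite ?muln0 ?mulr0 ?scale0r //=.
  by apply: UZ; apply: IHm; lia.
have := adZU (adZU Ur); rewrite (adZE 0) /= ?muln0 ?mulr0 ?scale0r ?subr0.
rewrite linearD !linearZ /= => /U_cancel/(_ (nat2_neq0 _) (UZ _ Z1)).
rewrite muln1 => /(_ isT).
rewrite adZE /= ?muln0 ?mulr0 ?scale0r ?sub0r ?addr0 -(scaleNr _ (T 0 1 r.+2)) => H.
apply: (U_cancel H); first by rewrite oppr_eq0 nat2_neq0.
by apply/UN/UZ.
Qed.

(** Applying [adX] twice to Y^q Z^(r+2) yields Y^(q+2) Z^r plus monomials whose Y-exponent is at
    most q. *)
Lemma odd_in_of_Y1 p : (forall r, odd r -> U (T p 1 r)) -> odd_in p.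
Proof.
move=> U1 q; have [m] := ubnP q; elim: m q => // m IHm [|[|q]] // lt_qm r q_odd r_odd.
  exact: U1.
have {}q_odd : odd q by move: q_odd; rewrite /= negbK.
have Uq : U (T p q r.+2) by apply: IHm => //; [lia | rewrite /= negbK].
have Y1 : U (adX (T p q.-1 r.+3)).
  rewrite adXE /= muln1; apply: UB; first by apply: UZ; rewrite prednK //; lia.
  case: q q_odd lt_qm {Uq} => [|[|q]] // q_odd lt_qm; rewrite ?muln0 ?mulr0 ?scale0r //=.
  by apply: UZ; apply: IHm; rewrite ?negbK //; lia.
have := adXU (adXU Uq); rewrite (adXE p q) /=.
rewrite linearB !linearZ /= => /U_cancel/(_ (nat2_neq0 _) (UZ _ (UN Y1))).
rewrite muln1 => /(_ isT).
rewrite adXE /= => H; apply: (U_cancel H); first exact: nat2_neq0.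
by apply/UN/UZ.
Qed.

(** Apply [adX] after [adZ] to X^p Y Z^r. The terms with X^(p-1) are settled by induction on p and
    the one through X^(p+1) Z^(r-1) by induction on r; what remains is a nonzero multiple of X^(p+1)
    Y Z^r. *)
Lemma odd_in_generated p : odd_in p.
Proof.
have [m] := ubnP p; elim: m p => // m IHm [|p] lt_pm; first exact/odd_in_of_Y1/Y1_odd_in.
have U2 c q r' : ~~ odd q -> ~~ odd r' -> U ((2 * (c * (0 < p))%:R) *: - adX (T p.-1 q r')).
  case: p lt_pm => [|p] lt_pm q_even r_even; first by rewrite muln0 mulr0 scale0r.
  by apply/UZ/UN/adX_even => //; apply: IHm; lia.
apply: odd_in_of_Y1 => r; have [k] := ubnP r; elim: k r => // k IHk r lt_rk r_odd.
have r0 : (0 < r)%N by case: r r_odd {lt_rk}.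
have Up : U (T p 1 r) by apply: IHm => //; lia.
have U3 : U (adX (T p.+1 0 r.-1)).
  rewrite adXE muln0 mulr0 scale0r subr0; case: r r_odd lt_rk {r0 Up} (IHk r.-2) => [|[|r]] // r_odd lt_rk IH.
    by rewrite muln0 mulr0 scale0r.
  by apply: UZ; apply: IH; lia.
have := adXU (adZU Up); rewrite adZE /= r0 !andbT muln1 !(linearB, linearD) !linearZ /=.
rewrite -!addrA => /U_cancel/(_ (nat2_neq0 _)); rewrite muln_gt0 => /(_ isT).
have r_even : ~~ odd r.-1 /\ ~~ odd r.+1 by case: r r_odd {lt_rk r0 Up U3} => //= r ->.
have [r1 r2] := r_even; move=> /(_ (UD (U2 _ _ _ _ _) (UD (UZ _ U3) (U2 _ _ _ _ _)))).
move=> /(_ isT r2 isT r1); rewrite adXE /= muln0 mulr0 scale0r subr0 -[_ *: _]addr0 => H.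
by apply: (U_cancel H) => //; apply: nat2_neq0.
Qed.
End Generated.

(** Applied with [U] the span of the proposed basis. *)
Section Ideal.
Hypothesis odd_U : forall p, odd_in p.
Hypothesis adX_odd : forall p q r, odd q -> odd r -> U (adX (T p q r)).
Hypothesis adZ_Y1 : forall p r, odd r -> U (adZ (T p 1 r)).

Let U_cong k l c c' A B D : k != 0 -> k * c' = l * c ->
  U (k *: A - l *: B) -> U (B - c *: D) -> U (A - c' *: D).
Proof.
move=> k0 kc' UAB UBD; rewrite -[_ - _]scale1r -(mulVf k0) -scalerA; apply: UZ.
rewrite scalerBr scalerA kc' -scalerA -[k *: A](subrK (l *: B)) -addrA -scalerBr.
by apply: UD => //; apply: UZ.
Qed.

(* Modulo the image of the odd part under [adX], the monomials in Y and Z of  *)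
(* given degree are multiples of one another, with binomial ratios.           *)
Lemma even_cong p i j : U (T p i.*2 j.*2 - 'C(i + j, i)%:R *: T p 0 (i + j).*2).
Proof.
elim: i j => [|i IHi] j; first by rewrite bin0 scale1r subrr.
have := adX_odd p (_ : odd i.*2.+1) (_ : odd j.*2.+1); rewrite /= !odd_double => /(_ isT isT).
rewrite adXE /= => H; apply: U_cong H _; rewrite ?nat2_neq0 //; last first.
  by rewrite -doubleS addSnnS; apply: IHi.
rewrite -!natrM; congr _%:R.
have := mul_bin_left (i + j.+1) i; rewrite addKn addnS addSn; nia.
Qed.

Let U_term k l c c' K A B D : U (A - c *: D) -> U (B - c' *: D) -> k * c = K * (l * c') ->
  U (k *: A - K *: (l *: B)).
Proof.
move=> UA UB' E; rewrite -(subrK (k *: (c *: D)) (k *: A)) -addrA -scalerBr.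
apply: UD; first exact: UZ.
by rewrite !scalerA E mulrA -!scalerA -!scalerBr; do 2!apply: UZ; rewrite -opprB; apply: UN.
Qed.

(** Modulo [U], [adZ] of X^p Y^(2i+1) Z^(2j+1) is 'C(i + j, i) times [adZ] of X^p Y Z^(2(i+j)+1).
    The four even terms are compared one by one with [even_cong], each pair reducing to the same
    monomial without Y. *)
Lemma adZ_odd p q r : odd q -> odd r -> U (adZ (T p q r)).
Proof.
move=> q_odd r_odd; rewrite -(odd_double_half q) -(odd_double_half r) q_odd r_odd !add1n.
move: q./2 r./2 => i j {q r q_odd r_odd}.
rewrite -[adZ _](subrK ('C(i + j, i)%:R *: adZ (T p 1 (i + j).*2.+1))).
apply: UD; last by apply: UZ; apply: adZ_Y1; rewrite /= odd_double.
have C1 := even_cong p.+1 i j.+1; have C1' := even_cong p.+1 0 (i + j).+1.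
have C2 := even_cong p.-1 i.+1 j.+1; have C2' := even_cong p.-1 1 (i + j).+1.
have C3 := even_cong p.+1 i j; have C3' := even_cong p.+1 0 (i + j).
have C4 := even_cong p.-1 i.+1 j; have C4' := even_cong p.-1 1 (i + j).
rewrite !addSn ?addnS in C1 C1' C2 C2' C3 C3' C4 C4'; rewrite ?add0n in C1' C2' C3' C4'.
rewrite !adZE /= !muln1.
(* Both monomials have the same total degree, hence the same number of identity sites. *)
have -> : (n.+1 - p - 1 - (i + j).*2.+1 = n.+1 - p - i.*2.+1 - j.*2.+1)%N by lia.
move: (n.+1 - p - _ - _)%N => m.
have B1 := mul_bin_down (i + j).+1 i; have B2 := mul_bin_diag (i + j).+2 i.
have B3 := mul_bin_diag (i + j).+1 i.
have {}B1 : ((i + j).+1 * 'C(i + j, i) = j.+1 * 'C((i + j).+1, i))%N.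
  by rewrite B1; congr (_ * _)%N; lia.
have rearrange (a b c d a' b' c' d' : V) k : a - b + c - d - k *: (a' - b' + c' - d') =
    (a - k *: a') - (b - k *: b') + (c - k *: c') - (d - k *: d').
  rewrite !(scalerBr, scalerDr) !opprD !opprK.
  by rewrite [LHS](AC (4*4) ((1*5)*(2*6)*(3*7)*(4*8))).
rewrite rearrange; apply: UB; first apply: UD; first apply: UB.
- apply: (U_term C1 C1'); rewrite -!natrM bin0; congr _%:R.
  have := congr1 (muln p.+1) B1; move: 'C(_, _) 'C(_, _); nia.
- apply: (U_term C2 C2'); rewrite -!natrM bin1; congr _%:R.
  case: (0 < p)%N; rewrite ?muln0 ?mul0n ?muln0 // !muln1.
  have := congr1 (muln j.+1) B2; have := congr1 (muln (i + j).+2) B1.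
  move: 'C(_, _) 'C(_, _) 'C(_, _); nia.
- by apply: (U_term C3 C3'); rewrite -!natrM bin0 muln1 mulnC.
- apply: (U_term C4 C4'); rewrite -!natrM bin1; congr _%:R.
  case: (0 < p)%N; rewrite ?muln0 ?mul0n ?muln0 // !muln1.
  have := congr1 (muln m) B3; move: 'C(_, _) 'C(_, _); nia.
Qed.

Lemma adX_adX p q r : odd q -> odd r -> U (adX (adX (T p q r))).
Proof.
move=> q_odd r_odd; rewrite (adXE p q r) linearB !linearZ /=.
by apply: UD; apply: UZ; rewrite ?linearN; try apply: UN; apply: adX_even => //; lia.
Qed.

Lemma adZ_adX p q r : odd q -> odd r -> U (adZ (adX (T p q r))).
Proof.
move=> q_odd r_odd; rewrite (adXE p q r) linearB !linearZ /=.
by apply: UD; apply: UZ; rewrite ?linearN; try apply: UN; apply: adZ_even => //; lia.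
Qed.

Lemma adX_adZ p q r : odd q -> odd r -> U (adX (adZ (T p q r))).
Proof.
move=> q_odd r_odd; rewrite (adZE p q r) !(linearB, linearD) !linearZ /=.
by apply: UD; first apply: UD; first apply: UD; apply: UZ; try apply: UN;
  apply: adX_even => //; lia.
Qed.

Lemma adZ_adZ p q r : odd q -> odd r -> U (adZ (adZ (T p q r))).
Proof.
move=> q_odd r_odd; rewrite (adZE p q r) !(linearB, linearD) !linearZ /=.
by apply: UD; first apply: UD; first apply: UD; apply: UZ; try apply: UN;
  apply: adZ_even => //; lia.
Qed.
End Ideal.
End LadderRelations.

(** * Linear independence and functionals *)

Lemma free_map (K : fieldType) (V : vectType K) (I : eqType) (F : I -> V) (s : seq I) :
  (forall k : I -> K, \sum_(x <- s) k x *: F x = 0 -> {in s, forall x, k x = 0}) ->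
  uniq s -> free (map F s).
Proof.
elim: s => [|x s IHs] freeF; first by rewrite nil_free.
case/andP=> xs us; have fs : free (map F s).
  apply: IHs => // k k0 y ys; pose k' z := if z == x then 0 else k z.
  have nyx : y != x by apply: contraNneq xs => <-.
  suff : k' y = 0 by rewrite /k' (negPf nyx).
  apply: freeF; last by rewrite inE ys orbT.
  rewrite big_cons /k' eqxx scale0r add0r -[RHS]k0; apply: eq_big_seq => z zs.
  by case: eqP xs => // <-; rewrite zs.
rewrite free_cons fs andbT; apply/negP => /(free_span fs)[k Fx _].
pose k' z := if z == x then -1 else k (F z).
suff /eqP : k' x = 0 by rewrite /k' eqxx oppr_eq0 oner_eq0.
apply: freeF; last exact: mem_head.
rewrite big_cons /k' eqxx scaleN1r Fx big_map addrC; apply/eqP; rewrite subr_eq0; apply/eqP.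
by apply: eq_big_seq => z zs; case: eqP xs => // <-; rewrite zs.
Qed.

(** In a linear relation [phi x] kills every other term of weight at least that of x, and the
    coefficients of lighter terms are zero by induction. *)
Lemma free_triangular (K : fieldType) (V : vectType K) (I : eqType) (F : I -> V)
    (mu : I -> nat) (phi : I -> {linear V -> K^o}) (s : seq I) :
    {in s, forall x, phi x (F x) != 0} ->
    {in s &, forall x y, x != y -> (mu x <= mu y)%N -> phi x (F y) = 0} ->
  uniq s -> free (map F s).
Proof.
move=> phi_neq0 phi_eq0 us; apply: free_map => // k k0 x.
have [m] := ubnP (mu x); elim: m x => // m IHm x lt_xm xs.
have /(congr1 (phi x)) := k0; rewrite linear0 linear_sum (bigD1_seq x) //= big_seq_cond big1.
  by rewrite addr0 linearZ => /eqP; rewrite scaler_eq0 (negPf (phi_neq0 x xs)) orbF => /eqP.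
move=> y /andP[ys nyx]; rewrite linearZ /=; have [le_xy | lt_yx] := leqP (mu x) (mu y).
  by rewrite phi_eq0 ?scaler0 // eq_sym.
by rewrite IHm ?scale0r //; apply: leq_trans lt_yx _.
Qed.

(** * Functionals adapted to the three families *)

Section Functionals.
Variables (R : realFieldType) (V : lmodType R) (n : nat).
Variables (T : nat -> nat -> nat -> V) (adX adZ : V -> V).
Hypothesis adXE : forall p q r, adX (T p q r) =
  (2 * (q.+1 * (0 < r))%:R) *: T p q.+1 r.-1 - (2 * (r.+1 * (0 < q))%:R) *: T p q.-1 r.+1.
Hypothesis adZE : forall p q r, adZ (T p q r) =
  (2 * (r.+1 * p.+1 * (0 < q))%:R) *: T p.+1 q.-1 r.+1
  - (2 * (r.+1 * q.+1 * (0 < p))%:R) *: T p.-1 q.+1 r.+1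
  + (2 * ((n.+1 - p - q - r) * p.+1 * ((0 < q)%N && (0 < r)%N))%:R) *: T p.+1 q.-1 r.-1
  - (2 * ((n.+1 - p - q - r) * q.+1 * ((0 < p)%N && (0 < r)%N))%:R) *: T p.-1 q.+1 r.-1.
(** Instantiated by [dual]. Prescribed values have to vanish above degree n, where the monomials
    themselves are zero. *)
Variable phi : (nat -> nat -> nat -> R) -> {linear V -> R^o}.
Hypothesis phiT : forall u, (forall p q r, (n < p + q + r)%N -> u p q r = 0) ->
  forall p q r, phi u (T p q r) = u p q r.

Section Functional.
Variable u : nat -> nat -> nat -> R.
Hypothesis u_eq0 : forall p q r, (n < p + q + r)%N -> u p q r = 0.

Lemma phi_adX p q r : phi u (adX (T p q r)) =
  2 * ((q.+1 * (0 < r))%:R * u p q.+1 r.-1 - (r.+1 * (0 < q))%:R * u p q.-1 r.+1).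
Proof.
rewrite adXE linearB !linearZ /= !(phiT u_eq0).
by rewrite /GRing.scale /=; ring.
Qed.

Lemma phi_adZ p q r : phi u (adZ (T p q r)) =
  2 * ((r.+1 * p.+1 * (0 < q))%:R * u p.+1 q.-1 r.+1
    - (r.+1 * q.+1 * (0 < p))%:R * u p.-1 q.+1 r.+1
    + ((n.+1 - p - q - r) * p.+1 * ((0 < q)%N && (0 < r)%N))%:R * u p.+1 q.-1 r.-1
    - ((n.+1 - p - q - r) * q.+1 * ((0 < p)%N && (0 < r)%N))%:R * u p.-1 q.+1 r.-1).
Proof.
rewrite adZE !(linearB, linearD) !linearZ /= !(phiT u_eq0).
by rewrite /GRing.scale /=; ring.
Qed.

End Functional.

(* The weights of a functional that kills the odd family and its image under  *)
(* [adX]; on even monomials of degree m.*2 in Y and Z such a functional is    *)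
(* unique up to a factor, by [even_cong].                                     *)
Definition wt (P m p q r : nat) : R :=
  if [&& p == P, ~~ odd q, ~~ odd r & (q + r == m.*2)%N] then 'C(m, q./2)%:R else 0.

Lemma wt_eq0 P m : (P + m.*2 <= n)%N -> forall p q r, (n < p + q + r)%N -> wt P m p q r = 0.
Proof. by move=> le_n p q r lt_n; rewrite /wt; case: and4P => // -[/eqP Ep _ _ /eqP Eq]; lia. Qed.

Lemma wt_adX P m p q r : odd q -> odd r ->
  (q.+1 * (0 < r))%:R * wt P m p q.+1 r.-1 = (r.+1 * (0 < q))%:R * wt P m p q.-1 r.+1.
Proof.
move=> q_odd r_odd; rewrite -(odd_double_half q) -(odd_double_half r) q_odd r_odd !add1n.
move: q./2 r./2 => i j; rewrite /wt /= !odd_double /=.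
have -> : (i.*2.+2 + j.*2 == m.*2) = (m == (i + j).+1) by lia.
have -> : (i.*2 + j.*2.+2 == m.*2) = (m == (i + j).+1) by lia.
case: (p == P) => /=; last by rewrite !mulr0.
case: eqP => [->|_]; last by rewrite !mulr0.
rewrite -doubleS !doubleK !muln1 -!natrM; congr _%:R.
have := mul_bin_left (i + j).+1 i; have -> : ((i + j).+1 - i = j.+1)%N by lia.
by nia.
Qed.

(* Up to a factor, the trace pairing with the Casimir element X^2 + Y^2 + Z^2. *)
Definition psiZ (p q r : nat) : R := [|| (p == 2) && (q == 0) && (r == 0),
  (p == 0) && (q == 2) && (r == 0) | (p == 0) && (q == 0) && (r == 2)]%N%:R.

(* For n = k.*2.+1 and up to a factor, the trace pairing with the product of  *)
(* all the X_j times the central element that sums, over the matchings with   *)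
(* k edges {a, b}, the products of the X_a X_b + Y_a Y_b + Z_a Z_b.           *)
Definition psiX (k p q r : nat) : R :=
  (-1) ^+ (q + r)./2 * 'C(k, (q + r)./2)%:R * wt 1 (q + r)./2 p q r.

Lemma psiZ_eq0 p q r : (2 <= n)%N -> (n < p + q + r)%N -> psiZ p q r = 0.
Proof.
by move=> n2 lt_n; rewrite /psiZ; case: p lt_n => [|[|[|p]]]; case: q => [|[|[|q]]];
  case: r => [|[|[|r]]] //=; lia.
Qed.

Lemma psiX_eq0 k p q r : n = k.*2.+1 -> (n < p + q + r)%N -> psiX k p q r = 0.
Proof.
move=> nk lt_n; rewrite /psiX /wt; case: and4P => [[/eqP p1 _ _ /eqP E]|]; last by rewrite mulr0.
by rewrite (bin_small (_ : k < _)%N) ?mulr0 ?mul0r //; lia.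
Qed.

(** The Casimir element commutes with the sums of the X_j and of the Z_j, hence with both
    generators, so by invariance its pairing with their brackets vanishes. Here and in [psiZ_adZ]
    this is checked on exponents. *)
Lemma psiZ_adX p q r : (2 <= n)%N -> odd q -> odd r -> phi psiZ (adX (T p q r)) = 0.
Proof.
move=> n2 q_odd r_odd; rewrite phi_adX => [|p' q' r']; last exact: psiZ_eq0.
rewrite /psiZ; case: p => [|[|[|p]]]; case: q q_odd => [|[|[|[|q]]]] // _;
  by case: r r_odd => [|[|[|r]]] // _ /=; rewrite ?mulr0 ?subrr ?mulr0.
Qed.

Lemma psiZ_adZ p r : (2 <= n)%N -> odd r -> phi psiZ (adZ (T p 1 r)) = 0.
Proof.
move=> n2 r_odd; rewrite phi_adZ => [|p' q' r']; last exact: psiZ_eq0.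
rewrite /psiZ; case: p => [|[|[|[|p]]]];
  by case: r r_odd => [|[|[|r]]] // _ /=; rewrite ?muln0 ?muln1 ?mulr0 ?subrr ?add0r ?addr0 ?subr0 ?subrr ?mul0r ?oppr0 ?mulr0.
Qed.

Lemma psiX_adX k p q r : n = k.*2.+1 -> odd q -> odd r -> phi (psiX k) (adX (T p q r)) = 0.
Proof.
move=> nk q_odd r_odd; rewrite phi_adX => [|p' q' r']; last exact: psiX_eq0.
rewrite /psiX; have -> : (q.-1 + r.+1 = q.+1 + r.-1)%N by lia.
set h := (_./2); rewrite ![_%:R * (_ * _)]mulrCA -mulrBr.
by rewrite (wt_adX 1 h p q_odd r_odd) subrr !mulr0.
Qed.

(** Only p = 0 and p = 2 reach X-exponent 1. In each case the two surviving terms cancel, by the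
    alternating sign and the ratio of consecutive binomials 'C(k, _). *)
Lemma psiX_adZ k p r : n = k.*2.+1 -> odd r -> phi (psiX k) (adZ (T p 1 r)) = 0.
Proof.
move=> nk r_odd; rewrite phi_adZ => [|p' q' r']; last exact: psiX_eq0.
rewrite -(odd_double_half r) r_odd add1n /=; move: r./2 => m {r r_odd}.
rewrite /psiX /wt /= !add0n ![in (2 + _)%N]addnC !addn2 -!doubleS !doubleK !odd_double /= !eqxx !andbT /=.
rewrite bin0 bin1.
case: p => [|[|[|p]]] /=; rewrite ?(mulr0, addr0, subr0, sub0r, oppr0) //.
  have -> : (n.+1 - 0 - 1 - m.*2.+1 = (k - m).*2)%N by lia.
  have := mul_bin_left k m => E; rewrite ?muln0 ?mul0r ?subr0 bin0 !muln1 ?mulr1 exprS.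
  have -> : m.+1.*2%:R * (-1 * (-1) ^+ m * 'C(k, m.+1)%:R) =
      - ((-1) ^+ m * (2 * (m.+1 * 'C(k, m.+1)))%:R) :> R by rewrite -muln2 !natrM; ring.
  by rewrite E -muln2 !natrM; ring.
have -> : (n.+1 - 2 - 1 - m.*2.+1 = (k - m.+1).*2)%N by lia.
have := mul_bin_left k m.+1 => E; rewrite bin1 !muln1 (exprS _ m.+1).
have -> : (m.+1.*2 * 2)%:R * (-1 * (-1) ^+ m.+1 * 'C(k, m.+2)%:R * m.+2%:R) =
    - ((-1) ^+ m.+1 * (4 * m.+1 * (m.+2 * 'C(k, m.+2)))%:R) :> R by rewrite -muln2 !natrM; ring.
by rewrite E -muln2 !natrM; ring.
Qed.

End Functionals.

(** * The dynamical Lie algebra *)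

Section DynamicalLieAlgebra.
Variables (R : realType) (n : nat).
Local Notation V := (cmat R (2 ^ n)).
Local Notation T := (XYZ R n).
Local Notation adX := (lie (T 1 0 0)).
Local Notation adZ := (lie (T 0 0 2)).
Local Notation g := (dla_K R n).
Local Notation B := (semisimple_basis R n).
Local Notation string := {ffun 'I_n -> (bool * bool)%type}.
Local Notation index3 := ('I_n.+1 * 'I_n.+1 * 'I_n.+1)%type.
Local Notation index2 := ('I_n.+1 * 'I_n.+1)%type.

Definition of_type p q r (f : string) :=
  [&& cnt (true, false) f == p, cnt (true, true) f == q & cnt (false, true) f == r].

(* The division by the number of strings makes the trace pairing with a       *)
(* string sum read off the weight [u]; see [dual_XYZ].                        *)
Definition dual (u : nat -> nat -> nat -> R) : {linear V -> R^o} :=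
  trform (mat n (fun p q r => - (u p q r / (2 ^+ n * #|[pred f | of_type p q r f]|%:R)))).

Lemma dual_XYZ u : (forall p q r, (n < p + q + r)%N -> u p q r = 0) ->
  forall p q r, dual u (T p q r) = u p q r.
Proof.
move=> u0 p q r; have [lt_n|le_n] := ltnP n (p + q + r).
  by rewrite XYZ_eq0 // linear0 u0.
have c0 : #|[pred f | of_type p q r f]|%:R != 0 :> R.
  have [f [Xf Yf Zf]] := string_of_cnt le_n.
  rewrite pnatr_eq0 -lt0n; apply/card_gt0P; exists f.
  by rewrite inE /of_type Xf Yf Zf !eqxx.
rewrite XYZ_mat /dual /= trform_mat (bigID (of_type p q r)) /= [X in _ + X]big1 => [|f nf].
  rewrite (eq_bigr (fun=> - (u p q r / (2 ^+ n * #|[pred f | of_type p q r f]|%:R)))).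
    rewrite sumr_const addr0 -mulr_natr; field.
    by rewrite c0 mul1r expf_neq0 ?pnatr_eq0.
  move=> f ff; have /and3P[/eqP-> /eqP-> /eqP->] := ff.
  by rewrite /delta !eqxx mulr1.
by rewrite /delta -/(of_type p q r f) (negPf nf) mulr0.
Qed.

Definition idx p q r : index3 := (inord p, inord q, inord r).

Lemma idxP p q r : odd q -> odd r -> (p + q + r <= n)%N ->
  [/\ idx p q r \in XYZ_exponents n, (idx p q r).1.1 = p :> nat,
      (idx p q r).1.2 = q :> nat & (idx p q r).2 = r :> nat].
Proof.
move=> q_odd r_odd le_n; rewrite inE /idx /= !inordK; try lia.
by rewrite q_odd r_odd le_n.
Qed.

Lemma odd_XYZ_basis p q r : odd q -> odd r -> T p q r \in <<B>>%VS.
Proof.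
move=> q_odd r_odd; have [lt_n|le_n] := ltnP n (p + q + r); first by rewrite XYZ_eq0 ?mem0v.
have [mem_idx E1 E2 E3] := idxP q_odd r_odd le_n.
apply: memv_span; rewrite mem_cat; apply/orP; left; apply/mapP.
by exists (idx p q r); [rewrite mem_enum | rewrite E1 E2 E3].
Qed.

Lemma adX_odd_basis p q r : odd q -> odd r -> adX (T p q r) \in <<B>>%VS.
Proof.
move=> q_odd r_odd; have [lt_n|le_n] := ltnP n (p + q + r).
  by rewrite (XYZ_eq0 R lt_n) lie0r mem0v.
have [mem_idx E1 E2 E3] := idxP q_odd r_odd le_n.
apply: memv_span; rewrite !mem_cat; apply/orP; right; apply/orP; left; apply/mapP.
by exists (idx p q r); [rewrite mem_enum | rewrite E1 E2 E3].
Qed.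

Lemma adZ_Y1_basis p r : odd r -> adZ (T p 1 r) \in <<B>>%VS.
Proof.
move=> r_odd; have [lt_n|le_n] := ltnP n (p + 1 + r).
  by rewrite (XYZ_eq0 R lt_n) lie0r mem0v.
apply: memv_span; rewrite !mem_cat; apply/orP; right; apply/orP; right.
apply/mapP; exists (inord p, inord r); last by rewrite /= !inordK //; lia.
by rewrite mem_enum inE /= !inordK ?r_odd; lia.
Qed.

Variant basis_spec : V -> Prop :=
  | OddBasis p q r of odd q & odd r & (p + q + r <= n)%N : basis_spec (T p q r)
  | adXBasis p q r of odd q & odd r & (p + q + r <= n)%N : basis_spec (adX (T p q r))
  | adZBasis p r of odd r & (p + 1 + r <= n)%N : basis_spec (adZ (T p 1 r)).

Lemma basisP A : A \in B -> basis_spec A.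
Proof.
rewrite !mem_cat => /or3P[] /mapP[t]; rewrite mem_enum inE.
- by move=> /and3P[q_odd r_odd le_n] ->; apply: OddBasis.
- by move=> /and3P[q_odd r_odd le_n] ->; apply: adXBasis.
- by move=> /andP[r_odd le_n] ->; apply: adZBasis.
Qed.

Lemma span_basis_stable : {in <<B>>%VS, forall A, adX A \in <<B>>%VS /\ adZ A \in <<B>>%VS}.
Proof.
pose U A := A \in <<B>>%VS.
have U0 : U 0 := mem0v _.
have UD A A' : U A -> U A' -> U (A + A') := @memvD _ _ _ A A'.
have UZ k A : U A -> U (k *: A) := @memvZ _ _ _ k A.
have odd_U p : odd_in T U p by move=> q r; apply: odd_XYZ_basis.
have X := @adX_XYZ R n; have Z := @adZ_XYZ R n.
move=> A AB; split; move: A AB; apply: lie_span_sub => _ /basisP[p q r q1 r1 _|p q r q1 r1 _|p r r1 _].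
- exact: adX_odd_basis.
- exact: (adX_adX X U0 UD UZ odd_U).
- exact: (adX_adZ X Z U0 UD UZ odd_U).
- exact: (adZ_odd X Z U0 UD UZ adX_odd_basis adZ_Y1_basis).
- exact: (adZ_adX X Z U0 UD UZ odd_U).
- exact: (adZ_adZ Z U0 UD UZ odd_U).
Qed.

Lemma dla_KE : g = lie_gen [:: T 1 0 0; T 0 0 2].
Proof. by rewrite /dla_K mixerE complete_maxcutE. Qed.

Lemma adX_Z2 : adX (T 0 0 2) = 2 *: T 0 1 1.
Proof. by rewrite adX_XYZ /= muln0 mulr0 scale0r subr0 muln1 mulr1. Qed.

Lemma basis_sub_derived : (<<B>> <= lie_prod g g)%VS.
Proof.
have g_lie : lie_subalg g := lie_gen_subalg _.
have Xg : T 1 0 0 \in g.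
  by rewrite dla_KE (subvP (sub_lie_gen _)) // memv_span ?inE ?eqxx.
have Zg : T 0 0 2 \in g.
  by rewrite dla_KE (subvP (sub_lie_gen _)) // memv_span ?inE ?eqxx ?orbT.
pose U A := A \in lie_prod g g.
have U0 : U 0 := mem0v _.
have UD A A' : U A -> U A' -> U (A + A') := @memvD _ _ _ A A'.
have UZ k A : U A -> U (k *: A) := @memvZ _ _ _ k A.
have UX A : U A -> U (adX A) by move=> UA; apply: mem_lie_prod => //; apply: (subvP g_lie).
have UZZ A : U A -> U (adZ A) by move=> UA; apply: mem_lie_prod => //; apply: (subvP g_lie).
have YZ : U (T 0 1 1).
  have : U (2 *: T 0 1 1) by rewrite -adX_Z2; apply: mem_lie_prod.
  by rewrite /U rpredZeq pnatr_eq0.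
have odd_U := odd_in_generated (@adX_XYZ R n) (@adZ_XYZ R n) U0 UD UZ UX UZZ YZ.
apply/span_subvP => _ /basisP[p q r q1 r1 _|p q r q1 r1 _|p r r1 _].
- exact: odd_U.
- exact/UX/odd_U.
- exact/UZZ/odd_U.
Qed.

Lemma dla_K_derived : g = (<<[:: T 1 0 0; T 0 0 2]>> + <<B>>)%VS /\ lie_prod g g = <<B>>%VS.
Proof.
have gE := dla_KE; have sBs := basis_sub_derived.
have XB : {in <<B>>%VS, forall A, adX A \in <<B>>%VS}.
  by move=> A AB; case: (span_basis_stable AB).
have ZB : {in <<B>>%VS, forall A, adZ A \in <<B>>%VS}.
  by move=> A AB; case: (span_basis_stable AB) => _.
have XZB : adX (T 0 0 2) \in <<B>>%VS by rewrite adX_Z2; apply/memvZ/odd_XYZ_basis.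
have sBg : (<<B>> <= lie_gen [:: T 1 0 0; T 0 0 2])%VS.
  by rewrite -gE; apply: subv_trans sBs _; apply: lie_gen_subalg.
have [gB sB] := lie_gen2_derived XB ZB XZB sBg.
rewrite -gE in gB sB; split=> //; apply/eqP; rewrite eqEsubv sBs andbT.
exact: sB.
Qed.

(** Every element of g is some [mat c] with real coefficients, on which the form is minus a positive
    multiple of a sum of squares. *)
Lemma dla_K_definite A : A \in g -> trform A A = 0 -> A = 0.
Proof.
pose P (A : V) := exists c, A = mat n c.
have P0 : P 0 by exists (fun _ _ _ => 0); rewrite mat0.
have PD A1 A2 : P A1 -> P A2 -> P (A1 + A2).
  by case=> c1 -> [c2 ->]; rewrite matD; eexists.
have PZ k A1 : P A1 -> P (k *: A1) by case=> c ->; rewrite matZ; eexists.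
have PT p q r : P (T p q r) by rewrite XYZ_mat; eexists.
have Pspan X : {in X, forall A1, P A1} -> {in <<X>>%VS, forall A1, P A1}.
  move=> PX A1 /(@coord_span _ _ _ (in_tuple X)) ->.
  by elim/big_ind: _ => // i _; apply/PZ/PX/mem_nth.
rewrite dla_K_derived.1 => /memv_addP[A1 A1X [A2 A2B ->]].
have [c ->] : P (A1 + A2).
  apply: PD; last first.
    apply: Pspan A2B => _ /basisP[p q r _ _ _|p q r _ _ _|p r _ _] //.
      by rewrite [T p q r]XYZ_mat lieX_mat; eexists.
    by rewrite [T p 1 r]XYZ_mat lieZ_mat; eexists.
  by apply: Pspan A1X => A'; rewrite !inE => /orP[]/eqP->.
by move=> c0; rewrite -(mat0 R n); apply: eq_mat; apply: mat_def0.
Qed.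

Let X := @adX_XYZ R n.
Let Z := @adZ_XYZ R n.
Let D := dual_XYZ.

Lemma delta_eq0 p q r : (p + q + r <= n)%N ->
  forall p' q' r', (n < p' + q' + r')%N -> delta R p q r p' q' r' = 0.
Proof.
by move=> le_n p' q' r' lt_n; rewrite /delta; case: and3P => // -[/eqP ? /eqP ? /eqP ?]; lia.
Qed.

Lemma deltaC p q r p' q' r' : ~~ [&& p' == p, q' == q & r' == r]%N ->
  delta R p q r p' q' r' = 0.
Proof. by move/negPf; rewrite /delta => ->. Qed.

Lemma wt_out P m p q r :
  ~~ [&& p == P, ~~ odd q, ~~ odd r & (q + r == m.*2)%N] -> wt R P m p q r = 0.
Proof. by move/negPf; rewrite /wt => ->. Qed.

Local Notation index := (index3 + index3 + index2)%type.

Definition basis_fun (x : index) : V :=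
  match x with
  | inl (inl t) => T t.1.1 t.1.2 t.2
  | inl (inr t) => adX (T t.1.1 t.1.2 t.2)
  | inr t => adZ (T t.1 1 t.2)
  end.

Definition basis_index : seq index :=
  map (inl \o inl) (enum (XYZ_exponents n)) ++ map (inl \o inr) (enum (XYZ_exponents n))
  ++ map inr (enum (XZ_exponents n)).

Lemma basis_map : B = map basis_fun basis_index.
Proof. by rewrite !map_cat -!map_comp. Qed.

Lemma basis_index_uniq : uniq basis_index.
Proof.
rewrite !cat_uniq !map_inj_uniq ?enum_uniq /=; try by move=> x y [].
rewrite andbT; apply/andP; split; apply/hasPn=> x.
  by rewrite mem_cat => /orP[] /mapP[y _ ->] /=; apply/negP => /mapP[].
by move=> /mapP[y _ ->]; apply/negP => /mapP[].
Qed.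

Definition index_ok (x : index) : bool :=
  match x with
  | inl (inl t) | inl (inr t) => [&& odd t.1.2, odd t.2 & (t.1.1 + t.1.2 + t.2 <= n)%N]
  | inr t => odd t.2 && (t.1 + 1 + t.2 <= n)%N
  end.

Lemma mem_basis_index x : x \in basis_index -> index_ok x.
Proof.
by rewrite !mem_cat => /or3P[] /mapP[t]; rewrite mem_enum inE => ok ->.
Qed.

(* The family [adZ (T p 1 r)] comes before [adX (T p q r)], by decreasing p   *)
(* and then increasing r; the leading term of [adZ (T p 1 r)] is              *)
(* X^(p+1) Z^(r-1), that of [adX (T p q r)] is X^p Y^(q-1) Z^(r+1).           *)
Definition index_weight (x : index) : nat :=
  match x with
  | inl (inl t) => 0
  | inl (inr t) => n.+1 * n.+1 + t.1.2
  | inr t => (n - t.1) * n.+1 + t.2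
  end%N.

(** A [delta] reads off the leading monomial in the first two families. The third needs [wt], which
    vanishes on the whole heavier family [adX (T p q r)] by [wt_adX]. *)
Definition index_dual (x : index) : {linear V -> R^o} :=
  dual match x with
  | inl (inl t) => delta R t.1.1 t.1.2 t.2
  | inl (inr t) => delta R t.1.1 t.1.2.-1 t.2.+1
  | inr t => wt R t.1.+1 t.2./2
  end.

Lemma index_dual_diag : {in basis_index, forall x, index_dual x (basis_fun x) != 0}.
Proof.
move=> x /mem_basis_index; case: x => [[[[p q] r]|[[p q] r]]|[p r]] /=.
- move=> /and3P[_ _ le_n]; rewrite (D (delta_eq0 le_n)) /delta !eqxx oner_eq0 //.
- move=> /and3P[q_odd r_odd le_n].
  have le_n' : (p + q.-1 + r.+1 <= n)%N by lia.
  rewrite (phi_adX X D (delta_eq0 le_n')) deltaC; last by lia.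
  rewrite mulr0 sub0r mulrN oppr_eq0 /delta !eqxx mulr1 -natrM pnatr_eq0.
  by rewrite !muln_eq0; lia.
- move=> /andP[r_odd le_n].
  have le_n' : (p.+1 + r./2.*2 <= n)%N by lia.
  rewrite (phi_adZ Z D (wt_eq0 R le_n')) /=.
  rewrite (@wt_out p.+1 _ p.+1 0 r.+1); last by lia.
  rewrite (@wt_out p.+1 _ p.-1 2 r.+1); last by lia.
  rewrite (@wt_out p.+1 _ p.-1 2 r.-1); last by lia.
  rewrite /wt ifT ?bin0; last by lia.
  by rewrite !mulr0 !subr0 add0r mulr1 -natrM pnatr_eq0 !muln_eq0; lia.
Qed.

Lemma index_dual_triangular : {in basis_index &, forall x y, x != y ->
  (index_weight x <= index_weight y)%N -> index_dual x (basis_fun y) = 0}.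
Proof.
move=> x y /mem_basis_index x_ok /mem_basis_index y_ok.
case: x x_ok => [[[[p q] r]|[[p q] r]]|[p r]] /=.
- move=> /and3P[q_odd r_odd le_n]; have d0 := delta_eq0 le_n.
  case: y y_ok => [[[[p' q'] r']|[[p' q'] r']]|[p' r']] /=.
  + move=> _ ne _; rewrite (D d0) deltaC //; apply: contra ne => /and3P[Ep Eq Er].
    by apply/eqP; congr (inl (inl (_, _, _))); apply/esym/val_inj/eqP.
  + move=> /and3P[q_odd' r_odd' _] _ _; rewrite (phi_adX X D d0).
    by rewrite !deltaC ?mulr0 ?subr0 ?mulr0 //; lia.
  + move=> /andP[r_odd' _] _ _; rewrite (phi_adZ Z D d0).
    by rewrite !deltaC ?mulr0 ?subr0 ?addr0 ?mulr0 //; lia.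
- move=> /and3P[q_odd r_odd le_n].
  have le_n' : (p + q.-1 + r.+1 <= n)%N by lia.
  have d0 := delta_eq0 le_n'.
  case: y y_ok => [[[[p' q'] r']|[[p' q'] r']]|[p' r']] /=.
  + by move=> _ _; lia.
  + move=> /and3P[q_odd' r_odd' _] ne; rewrite leq_add2l => le_q.
    rewrite (phi_adX X D d0) (@deltaC _ _ _ p' q'.+1 r'.-1); last by lia.
    rewrite deltaC ?mulr0 ?subr0 ?mulr0 //; apply: contra ne => /and3P[Ep Eq Er].
    by apply/eqP; congr (inl (inr (_, _, _))); apply/esym/val_inj => /=; lia.
  + move=> /andP[_ le_p] _ le_w; exfalso; move: le_w; apply/negP; rewrite -ltnNge.
    have : ((n - p') * n.+1 <= n * n.+1)%N by rewrite leq_mul2r leq_subr orbT.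
    by have := ltn_ord r'; lia.
- move=> /andP[r_odd le_n].
  have le_n' : (p.+1 + r./2.*2 <= n)%N by lia.
  have w0 := wt_eq0 R le_n'.
  case: y y_ok => [[[[p' q'] r']|[[p' q'] r']]|[p' r']] /=.
  + by move=> /and3P[q_odd' r_odd' _] _ _; rewrite (D w0) wt_out //; lia.
  + move=> /and3P[q_odd' r_odd' _] _ _; rewrite (phi_adX X D w0).
    by rewrite (wt_adX R _ _ _ q_odd' r_odd') subrr mulr0.
  + move=> /andP[r_odd' le_p'] ne le_w; rewrite (phi_adZ Z D w0) /=.
    (* The weight is a numeral in base n.+1, so its order is lexicographic. *)
    have lt_pr : (p' < p)%N || (p' == p :> nat) && (r < r')%N.
      case: (ltngtP p' p) => //= [lt_p | Ep].
        have : ((n - p').+1 * n.+1 <= (n - p) * n.+1)%N by rewrite leq_mul2r; lia.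
        by have := ltn_ord r'; lia.
      move: le_w; rewrite Ep leq_add2l leq_eqVlt => /orP[/eqP Er|//].
      by case/eqP: ne; congr (inr (_, _)); apply/val_inj.
    by rewrite !wt_out ?mulr0 ?subr0 ?addr0 ?mulr0 //; lia.
Qed.

Lemma basis_free : free B.
Proof.
rewrite basis_map; apply: (free_triangular (mu := index_weight) (phi := index_dual)).
- exact: index_dual_diag.
- exact: index_dual_triangular.
- exact: basis_index_uniq.
Qed.

Lemma dim_derived : \dim (lie_prod g g) = size B.
Proof. by rewrite dla_K_derived.2; apply/eqP; have := basis_free. Qed.

Lemma dual_span u (S : seq V) :
  {in S, forall A, dual u A = 0} -> {in <<S>>%VS, forall A, dual u A = 0}.
Proof.
move=> uS A /(@coord_span _ _ _ (in_tuple S)) ->; rewrite linear_sum big1 // => i _.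
by rewrite linearZ /= uS ?scaler0 // mem_nth.
Qed.

Hypothesis n_ge2 : (2 <= n)%N.

Lemma Z2_notin : T 0 0 2 \notin <<B>>%VS.
Proof.
have psi0 p q r := @psiZ_eq0 R n p q r n_ge2.
have psiB : {in B, forall A, dual (psiZ R) A = 0}.
  move=> A /basisP[p q r q1 r1 _|p q r q1 r1 _|p r r1 _].
  - rewrite (D psi0) /psiZ; case: q q1 => [|[|[|q]]] // _; case: r r1 => [|r] // _;
    by rewrite ?andbF.
  - exact: (psiZ_adX X D).
  - exact: (psiZ_adZ Z D).
apply/negP => /(dual_span psiB)/eqP.
by rewrite (D psi0) /psiZ /= oner_eq0.
Qed.

Lemma X1_notin k : n = k.*2.+1 -> T 1 0 0 \notin <<T 0 0 2 :: B>>%VS.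
Proof.
move=> nk; have psi0 p q r := @psiX_eq0 R n k p q r nk.
have psiB : {in T 0 0 2 :: B, forall A, dual (psiX R k) A = 0}.
  move=> A; rewrite inE => /orP[/eqP->|]; first by rewrite (D psi0) /psiX wt_out ?mulr0.
  case/basisP => [p q r q1 r1 _|p q r q1 r1 _|p r r1 _].
  - by rewrite (D psi0) /psiX wt_out ?mulr0 // q1 andbF.
  - exact: (psiX_adX X D p nk).
  - exact: (psiX_adZ Z D p nk).
apply/negP => /(dual_span psiB)/eqP.
by rewrite (D psi0) /psiX /wt /= expr0 bin0 !mulr1 oner_eq0.
Qed.

(** [adZ] of Y Z^(r+1) combines X Z^(r+2) and X Z^r with nonzero coefficients as long as r + 2 is at
    most n, so membership descends in steps of two from X Z^n, which is zero for having degree n +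
    1. For n even the descent ends at X^1. *)
Lemma X1_in : ~~ odd n -> T 1 0 0 \in <<B>>%VS.
Proof.
move=> n_even.
suff XZ m : (m <= n./2)%N -> T 1 0 (n - m.*2) \in <<B>>%VS.
  by have := XZ n./2 (leqnn _); rewrite even_halfK // subnn.
elim: m => [|m IHm] lt_m; first by rewrite subn0 (XYZ_eq0 R) ?mem0v // addn0 add1n.
have XZm : T 1 0 (n - m.*2) \in <<B>>%VS by apply/IHm/ltnW.
have [r Er] : exists r, (n - m.*2 = r.+2)%N by exists (n - m.*2)%N.-2; lia.
rewrite Er in XZm; have -> : (n - m.+1.*2 = r)%N by lia.
have := @adZ_Y1_basis 0 r.+1; rewrite adZ_XYZ /= !muln0 !mulr0 !scale0r !subr0.
have r_odd : odd r.+1 by lia.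
move=> /(_ r_odd); rewrite rpredDl; last exact: memvZ.
by rewrite rpredZeq -natrM pnatr_eq0 => /orP[|//]; rewrite !muln_eq0; lia.
Qed.

Lemma dim_dla_K : \dim g = (1 + odd n + size B)%N.
Proof.
have fZ : free (T 0 0 2 :: B) by rewrite free_cons basis_free Z2_notin.
rewrite dla_K_derived.1; case: (boolP (odd n)) => [n_odd | n_even].
  have nk : n = n./2.*2.+1 by rewrite -[LHS]odd_double_half n_odd.
  have fXZ : free (T 1 0 0 :: T 0 0 2 :: B) by rewrite free_cons fZ (X1_notin nk).
  by rewrite -span_cat; apply/eqP.
rewrite span_cons -addvA [(<<[:: T 0 0 2]>> + _)%VS]addvC addvA.
have XB : (<[T 1 0 0]> <= <<B>>)%VS by rewrite -memvE X1_in.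
rewrite (addv_idPr XB).
by rewrite addvC -span_cat; apply/eqP.
Qed.

End DynamicalLieAlgebra.

(** * Counting the exponents *)

Section Counting.
Local Open Scope nat_scope.

Lemma sum_oddSS k (F : nat -> nat) :
  \sum_(r < k.+2) odd r * F r = F 1 + \sum_(r < k) odd r * F r.+2.
Proof.
rewrite !big_ord_recl /= mul0n add0n mul1n; congr (_ + _); apply: eq_bigr => r _.
by rewrite /bump /= !add1n /= negbK.
Qed.

(** Peeling off r = 1 and shifting by two turns the sum for a + 2 into the one for a. The parity
    term on the left makes the identity exact without division; the quadratic case below follows the
    same pattern. *)
Lemma sum_odd_linear k a : a <= k ->
  4 * (\sum_(r < k) odd r * (a - r)) + odd a = a ^ 2.
Proof.
have [m] := ubnP a; elim: m a k => // m IHm [|[|a]] k lt_am le_ak.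
- by rewrite big1 // => r _; rewrite sub0n muln0.
- by rewrite big1 // => -[[|r] lt_r] _; rewrite ?mul0n // subSS sub0n muln0.
case: k le_ak => [|[|k]] // le_ak.
rewrite (sum_oddSS k (fun r => a.+2 - r)).
rewrite (eq_bigr (fun r : 'I_k => odd r * (a - r))) => [|r _]; last by rewrite !subSS.
have lt_a : a < m by lia.
have le_a : a <= k by lia.
have := IHm a k lt_a le_a; rewrite subSS subn0 /= negbK.
by set S := \sum_(r < k) _; lia.
Qed.

Lemma sum_odd_quadratic k K b : b <= k -> b <= K ->
  24 * (\sum_(q < k) odd q * (\sum_(r < K) odd r * (b - q - r))) + (if odd b then b else 4 * b)
    = b ^ 3.
Proof.
have [m] := ubnP b; elim: m b k => // m IHm [|[|b]] k lt_bm le_bk le_bK.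
- by rewrite big1 // => q _; rewrite big1 ?muln0 // => r _; rewrite !sub0n muln0.
- rewrite big1 // => -[[|q] lt_q] _; rewrite ?mul0n // big1 ?muln0 // => r _.
  by rewrite subSS !sub0n muln0.
case: k le_bk => [|[|k]] // le_bk.
rewrite (sum_oddSS k (fun q => \sum_(r < K) odd r * (b.+2 - q - r))) /= negbK.
rewrite (eq_bigr (fun q : 'I_k => odd q * \sum_(r < K) odd r * (b - q - r))); last first.
  by move=> q _; congr (_ * _); apply: eq_bigr => r _; rewrite !subSS.
have le1 : b.+1 <= K by lia.
have := sum_odd_linear le1; rewrite subSS subn0 /=.
have lt_b : b < m by lia.
have le_b : b <= k by lia.
have := IHm b k lt_b le_b (ltnW (ltnW le_bK)); set s2 := \sum_(q < k) _; set s1 := \sum_(r < K) _.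
by case: (odd b) => /=; nia.
Qed.

Lemma sum_leq_pred k m : \sum_(p < k.+1) (p + m <= k) = k.+1 - m.
Proof.
transitivity (\sum_(p < k.+1) (p < k.+1 - m)); last by rewrite sum_ltn; lia.
by apply: eq_bigr => p _; congr nat_of_bool; lia.
Qed.

Lemma card_XZ_exponents n : #|XZ_exponents n| = \sum_(r < n.+1) odd r * (n - r).
Proof.
transitivity (\sum_(p < n.+1) \sum_(r < n.+1) ((p, r) \in XZ_exponents n)).
  rewrite pair_bigA /= -sum1_card big_mkcond.
  by apply: eq_bigr => -[p r] _; case: ifP.
rewrite exchange_big; apply: eq_bigr => r _ /=.
rewrite -[n - r]/(n.+1 - (1 + r)) -sum_leq_pred big_distrr; apply: eq_bigr => p _.
by rewrite inE /= addnA; case: (odd r); case: (_ <= n).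
Qed.

(** For given q and r, the admissible p number n.+1 - q - r. *)
Lemma card_XYZ_exponents n :
  #|XYZ_exponents n| = \sum_(q < n.+1) odd q * (\sum_(r < n.+1) odd r * (n.+1 - q - r)).
Proof.
transitivity (\sum_(p < n.+1) \sum_(q < n.+1) \sum_(r < n.+1) ((p, q, r) \in XYZ_exponents n)).
  rewrite pair_bigA pair_bigA /= -sum1_card big_mkcond.
  by apply: eq_bigr => -[[p q] r] _; case: ifP.
rewrite exchange_big; apply: eq_bigr => q _ /=.
rewrite exchange_big big_distrr; apply: eq_bigr => r _ /=.
rewrite -subnDA -sum_leq_pred !big_distrr; apply: eq_bigr => p _ /=.
by rewrite inE /= addnA; case: (odd q); case: (odd r); case: (_ <= n).
Qed.

Lemma size_semisimple_basis (R : rcfType) n :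
  12 * size (semisimple_basis R n) + (if odd n then n + 6 else 0)
    = n ^ 3 + 6 * n ^ 2 + (if odd n then 0 else 2 * n).
Proof.
rewrite !size_cat !size_map -!cardE card_XYZ_exponents card_XZ_exponents.
have := sum_odd_quadratic (leqnn n.+1) (leqnn n.+1).
have := sum_odd_linear (leqnSn n); set s1 := \sum_(r < n.+1) _; set s2 := \sum_(q < n.+1) _.
by rewrite /=; case: (odd n) => /=; nia.
Qed.

End Counting.

Theorem theorem6 (R : realType) (n : nat) (n_ge2 : (2 <= n)%N) :
  let g := dla_K R n in
  let c := lie_center g in
  let s := lie_prod g g in
  [/\ g = (c + s)%VS /\ directv (c + s),
      lie_semisimple s,
      (\dim s)%:R =
        (if odd n then 12^-1 * (n%:R ^+ 3 + 6 * n%:R ^+ 2 - n%:R - 6)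
         else 12^-1 * (n%:R ^+ 3 + 6 * n%:R ^+ 2 + 2 * n%:R)) :> rat,
      basis_of s (semisimple_basis R n)
    & \dim c = (1 + odd n)%N].
Proof.
move=> g c s.
have g_lie : lie_subalg g := lie_gen_subalg _.
have def_g := @dla_K_definite R n.
have disj : (c :&: s = 0)%VS := lie_center_derived_disjoint def_g.
have sum_cs : g = (c + s)%VS := lie_center_derived g_lie def_g.
have dim_s : \dim s = size (semisimple_basis R n) := dim_derived R n.
split.
- by split=> //; apply/directv_addP.
- exact: lie_derived_semisimple.
- rewrite dim_s; have := congr1 (fun k => k%:R : rat) (size_semisimple_basis R n).
  case: ifP => _; rewrite !(natrD, natrX, natrM); lra.
- by rewrite /basis_of /s (dla_K_derived R n).2 eqxx basis_free.
(* The center has the codimension of the derived algebra in g as its dimension. *)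
- apply: (@addIn (\dim s)); rewrite -(dimv_disjoint_sum disj) -sum_cs dim_s.
  exact: dim_dla_K.
Qed.
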